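(* Let $d\ge 3$ be an integer, let $\mathbf{K}$ be an ellipsoid in $\mathbb{R}^d$, and let $r\ge 1$ be an integer. Let $C_1,\dots,C_N$ be $2$-codimensional cylinders in $\mathbb{R}^d$ which form an $r$-fold packing in $\mathbf{K}$. Then $$\sum_{i=1}^N \mathrm{crv}_{\mathbf{K}}(C_i)\le r .$$
   Context: A convex body in $\mathbb{R}^d$ is a compact convex set with non-empty interior. $P_E$ denotes the orthogonal projection onto a linear subspace $E\subset\mathbb{R}^d$, $E^\perp$ the orthogonal complement of $E$, and $\mathrm{vol}_m$ the $m$-dimensional volume. For $0<k<d$, a $k$-codimensional cylinder is a set $C\subset\mathbb{R}^d$ that can be presented in the form $C=B+H$, where $H$ is a $k$-dimensional linear subspace of $\mathbb{R}^d$ and $B$ is a measurable set in $E:=H^\perp$. For a convex body $\mathbf{K}$ in $\mathbb{R}^d$ and a $k$-codimensional cylinder $C=B+H$ with $E=H^\perp$, the crossectional volume of $C$ with respect to $\mathbf{K}$ is $$\mathrm{crv}_{\mathbf{K}}(C)=\frac{\mathrm{vol}_{d-k}(B)}{\mathrm{vol}_{d-k}(P_E\mathbf{K})}.$$ Let $\mathbf{K}$ be a convex body in $\mathbb{R}^d$, let $C_i=B_i+H_i$, $i\le N$, be $k$-codimensional cylinders, $E_i=H_i^\perp$ and $\bar C_i=C_i\cap\mathbf{K}$. The $C_i$'s form an $r$-fold packing in $\mathbf{K}$ if $B_i\subset P_{E_i}\mathbf{K}$ for every $i\le N$ and each point of $\mathbf{K}$ belongs to at most $r$ of the interiors $\mathrm{int}(\bar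 C_i)$.
   Formalization: Each base B_i is additionally assumed to have vol(B_i \ relint B_i)=0 (true for open, convex or Jordan measurable bases); without it the claim fails, e.g. for B_i = P_{E_i}K minus a countable dense set, whose cylinders have empty interior. *)

(* Defs.v *)
(* Points of R^d are row vectors 'rV[R]_d; linear subspaces are row spaces of
   square matrices. *)
From HB Require Import structures.
From mathcomp Require Import all_boot all_order all_algebra.
From mathcomp Require Import all_classical all_reals all_analysis.

Set Implicit Arguments.
Unset Strict Implicit.
Unset Printing Implicit Defensive.
Import Order.TTheory GRing.Theory Num.Theory.
Import numFieldNormedType.Exports.

Local Open Scope classical_set_scope.
Local Open Scope ring_scope.

Section lebesgue.
Context {R : realType} (m : nat).
Implicit Types (a b : 'rV[R]_m) (A : set 'rV[R]_m).

Definition box a b : set 'rV[R]_m :=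
  [set x : 'rV[R]_m | forall i, a ord0 i <= x ord0 i <= b ord0 i].

Definition box_vol a b : R := \prod_(i < m) (b ord0 i - a ord0 i).

(* The corner condition is needed: the product of the signed side lengths of
   an empty box can be positive.  Covers are indexed by an arbitrary set D of
   naturals, so that finite covers are allowed; this only matters for m = 0,
   where every box has volume 1. *)
Definition lebesgue_outer A : \bar R :=
  ereal_inf [set v | exists (D : set nat) (a b : nat -> 'rV[R]_m),
    [/\ forall k i, a k ord0 i <= b k ord0 i,
        A `<=` \bigcup_(k in D) box (a k) (b k) &
        v = (\esum_(k in D) (box_vol (a k) (b k))%:E)%E]].

Definition lebesgue_measurable A : Prop := lebesgue_outer.-caratheodory A.

End lebesgue.

Section euclidean.
Context {R : realType} {d : nat}.
Implicit Types (E H A : 'M[R]_d) (K B : set 'rV[R]_d).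

Definition dotp (x y : 'rV[R]_d) : R := (x *m y^T) ord0 ord0.

Definition euclidean_ball : set 'rV[R]_d := [set x | dotp x x <= 1].

Definition ellipsoid K : Prop := exists (c : 'rV[R]_d) (A : 'M[R]_d),
  A \in unitmx /\ K = [set c + y *m A | y in euclidean_ball].

Definition subspace_set E : set 'rV[R]_d := [set x | (x <= E)%MS].

Definition orthocompl E : 'M[R]_d := kermx E^T.

Definition orthproj E (x : 'rV[R]_d) : 'rV[R]_d :=
  x *m proj_mx E (orthocompl E).

Definition orthonormal_basis E (U : 'M[R]_(\rank E, d)) : Prop :=
  U *m U^T = 1%:M /\ (U :=: E)%MS.

Definition onb E : 'M[R]_(\rank E, d) := xget 0 [set U | orthonormal_basis U].

(* The set B (contained in E) seen in R^(dim E) through the linear isometry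
   u |-> u *m onb E onto E. *)
Definition coords E B : set 'rV[R]_(\rank E) := [set u | B (u *m onb E)].

Arguments coords : clear implicits.

Definition subspace_vol E B : \bar R := lebesgue_outer (coords E B).

Definition measurable_in E B : Prop := lebesgue_measurable (coords E B).

Definition relative_interior E B : set 'rV[R]_d :=
  [set x | subspace_set E x /\
    exists U : set 'rV[R]_d, [/\ open U, U x & U `&` subspace_set E `<=` B]].

End euclidean.

Arguments coords {R d} E B _.

Record cylinder (R : realType) (d k : nat) := Cylinder {
  cyl_dir : 'M[R]_d;
  cyl_base : set 'rV[R]_d;
  cyl_codim : (0 < k < d)%N;
  cyl_dir_dim : \rank cyl_dir = k;
  cyl_base_sub : cyl_base `<=` subspace_set (orthocompl cyl_dir);
  cyl_base_meas : measurable_in (orthocompl cyl_dir) cyl_base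
}.

Section cylinders.
Context {R : realType} {d k : nat}.
Implicit Types (C : cylinder R d k) (K : set 'rV[R]_d).

Definition cyl_space C : 'M[R]_d := orthocompl (cyl_dir C).

Definition cyl_set C : set 'rV[R]_d :=
  [set b + h | b in cyl_base C & h in subspace_set (cyl_dir C)].

Definition crv K C : \bar R :=
  (subspace_vol (cyl_space C) (cyl_base C) /
   subspace_vol (cyl_space C) (orthproj (cyl_space C) @` K))%E.

Definition packing_in (N r : nat) K (C : 'I_N -> cylinder R d k) : Prop :=
  (forall i, cyl_base (C i) `<=` orthproj (cyl_space (C i)) @` K) /\
  (forall x, K x ->
    (#|[pred i | `[< (cyl_set (C i) `&` K)^° x >]]| <= r)%N).

(* Every relatively open or Jordan measurable base has this property.  Packing
   constrains only interiors of cylinders, hence says nothing about the volume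
   of a base outside its relative interior: P_E K minus a countable dense set
   has full volume, but the cylinder over it has empty interior, so any number
   of such cylinders form a packing. *)
Definition interior_full C : Prop :=
  subspace_vol (cyl_space C)
    (cyl_base C `\` relative_interior (cyl_space C) (cyl_base C)) = 0%E.

End cylinders.

(* Main.v *)
Require Import Defs.
From HB Require Import structures.
From mathcomp Require Import all_boot all_order all_algebra.
From mathcomp Require Import all_classical all_reals all_analysis.
From mathcomp Require Import measurable_realfun lra.
Import Order.TTheory GRing.Theory Num.Theory.
Import numFieldNormedType.Exports.
Local Open Scope classical_set_scope.
Local Open Scope ring_scope.
Set Implicit Arguments.
Unset Strict Implicit.
Unset Printing Implicit Defensive.

(** Archimedes discovered that the orthogonal projection of the unit sphere of
    R^3 to an axis carries the area of the sphere to a uniform measure.  The same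
    holds in every dimension d for projections to subspaces of dimension d - 2:
    the normalised measure of the sphere is carried to the uniform distribution
    on the unit ball of the subspace.  Let K be the image of the unit ball under
    an affine bijection, and transport the measure of the sphere to the boundary
    of K.  Then a cylinder with a 2-dimensional direction and a base B contained
    in the projection of K has measure equal to its crossectional volume,
    whatever its direction.  A boundary point of K that lies in the cylinders
    over the relative interiors of several bases can be moved slightly towards
    the centre of K, where it is interior to K and to all these cylinders at the
    same time; hence it lies in at most r of them.  Integrating this
    multiplicity over the boundary gives the inequality.

    Surface measure is replaced by Lebesgue measure on the unit ball, followed by
    the radial projection [sphere_proj] to the sphere.  After an orthogonal change
    of coordinates a point of R^(n+2) is a pair (y, z) with y in R^n and z in
    R^2.  The area of a disc is proportional to its squared radius, so s = |z|^2
    is distributed according to a multiple of Lebesgue measure on [0, oo[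
    ([rowvec_lebesgue_sqnorm]).  For a fixed y the substitution t = |y|^2 + s is
    a translation, and for a fixed t the condition that y / sqrt t lie in U
    defines a dilate of U, whose measure is a power of t times that of U.
    Therefore the measure of the points projected into U is a constant times
    that of U ([archimedes]); no integral has to be computed, because the
    constant disappears in the quotient.

    All the transformation rules that are needed come from one fact: two sigma
    finite translation invariant measures on R^n are proportional
    ([translation_invariant_unique]).  It yields the behaviour of Lebesgue measure
    under linear maps without determinants, and its identification with a
    product of lower dimensional Lebesgue measures.  Lebesgue measure itself is
    obtained by iterated products.  It is bounded above by the outer measure
    that covers sets by boxes, and on open sets it is bounded below by it, since
    an open set is a disjoint union of dyadic cubes; these two inequalities are
    what the denominator and the numerator of a crossectional volume need. *)

(** * Row vectors as a measurable space *)

(** The sigma-algebra is generated by the coordinates, so that measurability of a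
    vector-valued map is checked coordinatewise; open sets are shown to belong
    to it by means of dyadic cubes. *)
Definition rowvec_display : measure_display -> measure_display.
Proof. exact. Qed.

Section measurable_rowvec.
Context {R : realType} (n : nat).

Let coordf : 'I_n -> 'rV[R]_n -> R := fun i x => x ord0 i.

Let rowvec_set0 : g_sigma_preimage coordf set0.
Proof. exact: sigma_algebra0. Qed.

Let rowvec_setC A : g_sigma_preimage coordf A -> g_sigma_preimage coordf (~` A).
Proof. exact: sigma_algebraC. Qed.

Let rowvec_bigcup (F : _^nat) : (forall i, g_sigma_preimage coordf (F i)) ->
  g_sigma_preimage coordf (\bigcup_i (F i)).
Proof. exact: sigma_algebra_bigcup. Qed.

HB.instance Definition _ :=
  @isMeasurable.Build (rowvec_display default_measure_display)
  'rV[R]_n (g_sigma_preimage coordf) rowvec_set0 rowvec_setC rowvec_bigcup.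

Lemma measurable_coord (i : 'I_n) :
  measurable_fun setT (fun x : 'rV[R]_n => x ord0 i).
Proof.
move=> _ Y mY; rewrite setTI; apply: sub_sigma_algebra => /=.
rewrite -bigcup_seq/=; exists i => /=; first by rewrite mem_index_enum.
by exists Y => //; rewrite setTI.
Qed.

Lemma measurable_fun_rowvecP d (T : measurableType d) (f : T -> 'rV[R]_n) :
  (forall i, measurable_fun setT (fun t => f t ord0 i)) ->
  measurable_fun setT f.
Proof.
move=> mf _ A mA; rewrite setTI.
suff : g_sigma_preimage (fun i => coordf i \o f) `<=` measurable.
  rewrite g_sigma_preimage_comp => /(_ (f @^-1` A)); apply.
  by exists A => //; rewrite setTI.
apply: smallest_sub; first exact: sigma_algebra_measurable.
move=> B; rewrite -bigcup_seq/= => -[i _ [C mC <-]].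
exact: mf.
Qed.

End measurable_rowvec.

Section measurable_rowvec_theory.
Context {R : realType}.

Lemma measurable_mulmxr m n (M : 'M[R]_(m, n)) :
  measurable_fun setT (fun x : 'rV[R]_m => x *m M).
Proof.
apply: measurable_fun_rowvecP => j.
under eq_fun do rewrite mxE.
apply: measurable_sum => k; apply: measurable_funM => //.
exact: measurable_coord.
Qed.

Lemma measurable_rowvecD d (T : measurableType d) n (f g : T -> 'rV[R]_n) :
  measurable_fun setT f -> measurable_fun setT g ->
  measurable_fun setT (fun t => f t + g t).
Proof.
move=> mf mg; apply: measurable_fun_rowvecP => j.
under eq_fun do rewrite mxE.
by apply: measurable_funD; apply: (measurableT_comp (measurable_coord j)).
Qed.

Lemma measurable_rowvecZ d (T : measurableType d) n (a : T -> R)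
    (f : T -> 'rV[R]_n) :
  measurable_fun setT a -> measurable_fun setT f ->
  measurable_fun setT (fun t => a t *: f t).
Proof.
move=> ma mf; apply: measurable_fun_rowvecP => j.
under eq_fun do rewrite mxE.
by apply: measurable_funM => //; apply: (measurableT_comp (measurable_coord j)).
Qed.

Lemma measurable_rowvecN d (T : measurableType d) n (f : T -> 'rV[R]_n) :
  measurable_fun setT f -> measurable_fun setT (fun t => - f t).
Proof.
move=> mf; under eq_fun do rewrite -scaleN1r.
exact: measurable_rowvecZ.
Qed.

Lemma measurable_row_mx d (T : measurableType d) m n (f : T -> 'rV[R]_m)
    (g : T -> 'rV[R]_n) :
  measurable_fun setT f -> measurable_fun setT g ->
  measurable_fun setT (fun t => row_mx (f t) (g t)).
Proof.
move=> mf mg; apply: measurable_fun_rowvecP => j.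
under eq_fun do rewrite mxE.
by case: (fintype.split j) => k; apply: (measurableT_comp (measurable_coord k)).
Qed.

Lemma measurable_lsubmx m n :
  measurable_fun setT (lsubmx : 'rV[R]_(m + n) -> 'rV[R]_m).
Proof.
apply: measurable_fun_rowvecP => j.
under eq_fun do rewrite mxE.
exact: measurable_coord.
Qed.

Lemma measurable_dotp d (T : measurableType d) n (f g : T -> 'rV[R]_n) :
  measurable_fun setT f -> measurable_fun setT g ->
  measurable_fun setT (fun t => dotp (f t) (g t)).
Proof.
move=> mf mg; rewrite /dotp; under eq_fun do rewrite mxE.
apply: measurable_sum => k; under eq_fun do rewrite mxE.
by apply: measurable_funM; apply: (measurableT_comp (measurable_coord k)).
Qed.

Lemma measurable_le_set d (T : measurableType d) (f g : T -> R) :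
  measurable_fun setT f -> measurable_fun setT g ->
  measurable [set t | f t <= g t].
Proof.
move=> mf mg; rewrite -[X in measurable X]setTI.
by apply: (measurable_fun_ler mf mg measurableT (_ : measurable [set true])).
Qed.

Lemma measurable_euclidean_ball n : measurable (@euclidean_ball R n).
Proof. by apply: measurable_le_set => //; exact: measurable_dotp. Qed.

Lemma measurable_preimageT d1 d2 (T1 : measurableType d1) (T2 : measurableType d2)
    (f : T1 -> T2) A :
  measurable_fun setT f -> measurable A -> measurable (f @^-1` A).
Proof. by move=> mf mA; rewrite -[X in measurable X]setTI; exact: mf. Qed.

End measurable_rowvec_theory.

(** * Uniqueness of translation invariant measures *)

Section product_measure_symmetry.
Local Open Scope ereal_scope.
Context d1 d2 (T1 : measurableType d1) (T2 : measurableType d2) (R : realType).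
Variable m1 : {sigma_finite_measure set T1 -> \bar R}.
Variable m2 : {sigma_finite_measure set T2 -> \bar R}.

(** The two orders of integration give the same measure of a set: both measures
    agree on products. *)
Lemma product_measure12 (X : set (T1 * T2)) : measurable X ->
  (m1 \x m2) X = (m1 \x^ m2) X.
Proof.
move=> mX; apply: product_measure_unique => // A B mA mB.
exact: product_measure2E.
Qed.

End product_measure_symmetry.

Section sigma_finite_measure_of.
Context d (T : measurableType d) (R : realType).

(** The proof of sigma-finiteness is a parameter, which makes it recoverable by
    instance resolution. *)
Definition sigma_finite_of (m : {measure set T -> \bar R})
  (sm : sigma_finite setT m) : set T -> \bar R := m.

Variables (m : {measure set T -> \bar R}) (sm : sigma_finite setT m).

HB.instance Definition _ := Measure.on (sigma_finite_of sm).
HB.instance Definition _ :=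
  Measure_isSigmaFinite.Build _ _ _ (sigma_finite_of sm) sm.

End sigma_finite_measure_of.

Section pushforward_sigma_finite.
Local Open Scope ereal_scope.
Context d1 d2 (T1 : measurableType d1) (T2 : measurableType d2) (R : realType).
Variable nu : {measure set T1 -> \bar R}.
Variables (f : T1 -> T2) (mf : measurable_fun setT f).
Variable F : (set T2)^nat.
Hypotheses (FT : \bigcup_k F k = setT) (mF : forall k, measurable (F k)).
Hypothesis Foo : forall k, nu (f @^-1` F k) < +oo.

Lemma pushforward_sigma_finite :
  exists nu' : {sigma_finite_measure set T2 -> \bar R},
    forall A, nu' A = nu (f @^-1` A).
Proof.
have [m mE] : exists m : {measure set T2 -> \bar R},
    forall A, m A = nu (f @^-1` A).
  by unshelve eexists (pushforward nu f : {measure set T2 -> \bar R}).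
have sm : sigma_finite setT m.
  by exists F => // k; split; [exact: mF|rewrite mE; exact: Foo].
by exists (sigma_finite_of sm).
Qed.
End pushforward_sigma_finite.

Section translation_invariant.
Local Open Scope ereal_scope.
Context {R : realType} {n : nat}.
Implicit Types (nu : {sigma_finite_measure set 'rV[R]_n -> \bar R}).

Definition translation_invariant (nu : set 'rV[R]_n -> \bar R) :=
  forall (v : 'rV[R]_n) (A : set 'rV[R]_n), measurable A ->
    nu [set x | A (x + v)%R] = nu A.

(** Both sides are the product measure of S, the set of (x, y) with x in A and
    x + y in B.  Integrating in y first gives the left-hand side by invariance of
    nu'.  For a fixed y, invariance of nu replaces x by x - y and turns S into
    S', where the roles of the two factors are exchanged.  When A is symmetric
    and nu A is finite and nonzero, this says that nu' is a multiple of nu. *)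
Lemma translation_invariant_unique nu nu' (A B : set 'rV[R]_n) :
  translation_invariant nu -> translation_invariant nu' ->
  measurable A -> measurable B ->
  nu A * nu' B = nu' [set x : 'rV[R]_n | A (- x)%R] * nu B.
Proof.
move=> ti ti' mA mB.
have mD (b : bool) : measurable_fun setT
    (fun p : 'rV[R]_n * 'rV[R]_n => p.1 + (if b then p.2 else - p.2))%R.
  apply: measurable_rowvecD => //.
  by case: b; [|apply: measurable_rowvecN]; exact: measurable_snd.
pose S := [set p : 'rV[R]_n * 'rV[R]_n | A p.1 /\ B (p.1 + p.2)%R].
pose S' := [set p : 'rV[R]_n * 'rV[R]_n | A (p.1 - p.2)%R /\ B p.1].
have mS : measurable S.
  apply: measurableI; first exact: measurable_preimageT.
  exact: (measurable_preimageT (mD true)).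
have mS' : measurable S'.
  apply: measurableI; first exact: (measurable_preimageT (mD false)).
  exact: measurable_preimageT.
(* Sections of S at a fixed x are translates of B. *)
transitivity ((nu \x nu') S).
  rewrite /product_measure1.
  rewrite (eq_integral (fun x => (\1_A x)%:E * nu' B)); last first.
    move=> x _ /=; rewrite indicE.
    have [/set_mem Ax|/negP Ax] := boolP (x \in A).
      rewrite mul1e -(ti' x B mB) /=; congr (nu' _); apply/seteqP; split => y.
        by move=> /set_mem[_ /=]; rewrite addrC.
      by move=> /= Byx; apply/mem_set; split=> //=; rewrite addrC.
    rewrite mul0e (_ : xsection _ _ = set0)//.
    by apply/seteqP; split => y // /set_mem[/= Ax' _]; apply: Ax; exact/mem_set.
  by rewrite ge0_integralZr ?integral_indic ?setIT//; exact: measurableT_comp.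
rewrite product_measure12//.
transitivity ((nu \x^ nu') S').
  apply: eq_integral => y _ /=.
  rewrite -(ti y); last exact: measurable_ysection.
  congr (nu _); apply/seteqP; split => x.
    by move=> /set_mem[/= Ax Bx]; apply/mem_set; split; rewrite //= addrK.
  by move=> /set_mem[/=]; rewrite addrK => Ax Bx; apply/mem_set.
(* Sections of S' at a fixed x are translates of -A. *)
rewrite -product_measure12//.
transitivity (\int[nu]_x ((\1_B x)%:E * nu' [set x | A (- x)%R])).
  apply: eq_integral => x _ /=; rewrite indicE.
  have [/set_mem Ax|/negP Ax] := boolP (x \in B).
    rewrite mul1e -(ti' (- x)%R); last first.
      apply: (measurable_preimageT (f := fun x : 'rV[R]_n => - x)%R) => //.
      exact: measurable_rowvecN.
    congr (nu' _); apply/seteqP; split => y.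
      by move=> /set_mem[/=]; rewrite opprD opprK addrC.
    by rewrite /= opprD opprK addrC => Axy; apply/mem_set.
  rewrite mul0e (_ : xsection _ _ = set0)//.
  by apply/seteqP; split => y // /set_mem[/= _ Ax']; apply: Ax; exact/mem_set.
rewrite muleC ge0_integralZr ?integral_indic ?setIT 1?muleC//.
exact: measurableT_comp.
Qed.

End translation_invariant.

(** * Lebesgue measure on row vectors *)

Section product_measure_preserving.
Local Open Scope ereal_scope.
Context d1 d2 (T1 : measurableType d1) (T2 : measurableType d2) (R : realType).
Variable m1 : {sigma_finite_measure set T1 -> \bar R}.
Variable m2 : {sigma_finite_measure set T2 -> \bar R}.
Variables (g1 : T1 -> T1) (g2 : T2 -> T2).
Hypotheses (mg1 : measurable_fun setT g1) (mg2 : measurable_fun setT g2).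
Hypothesis m1g : forall A, measurable A -> m1 (g1 @^-1` A) = m1 A.
Hypothesis m2g : forall A, measurable A -> m2 (g2 @^-1` A) = m2 A.

(** Each factor is moved in the order of integration in which it is the inner
    variable, so no change of variables in an integral is needed. *)
Lemma product_measure_preserving S : measurable S ->
  (m1 \x m2) [set p | S (g1 p.1, g2 p.2)] = (m1 \x m2) S.
Proof.
move=> mS.
have mS1 : measurable [set p : T1 * T2 | S (g1 p.1, p.2)].
  apply: (measurable_preimageT (f := fun p : T1 * T2 => (g1 p.1, p.2))) => //.
  by apply: measurable_fun_pair => //; exact: measurableT_comp.
transitivity ((m1 \x m2) [set p | S (g1 p.1, p.2)]).
  apply: eq_integral => x _ /=.
  rewrite -[RHS]m2g; last exact: measurable_xsection.
  by congr (m2 _); apply/seteqP; split => y /set_mem Sxy; exact/mem_set.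
rewrite !product_measure12//.
apply: eq_integral => y _ /=.
rewrite -[RHS]m1g; last exact: measurable_ysection.
by congr (m1 _); apply/seteqP; split => x /set_mem Sxy; exact/mem_set.
Qed.

End product_measure_preserving.

Section lebesgue_rowvec.
Local Open Scope ereal_scope.
Context {R : realType}.

Lemma lebesgue_measureD (a : R) (A : set R) : measurable A ->
  lebesgue_measure [set x : R | A (x + a)%R] = lebesgue_measure A.
Proof.
move=> mA.
have ma : measurable_fun setT
    ((fun x : R => x + a)%R : measurableTypeR R -> measurableTypeR R).
  exact: measurable_funD.
rewrite -[LHS]/(pushforward lebesgue_measure
  ((fun x : R => x + a)%R : measurableTypeR R -> measurableTypeR R) A).
apply/esym/lebesgue_measure_unique => //= _ [[u v]] _ <-.
rewrite /pushforward/=.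
rewrite (_ : _ @^-1` _ = `](u - a)%R, (v - a)%R]%classic); last first.
  by apply/seteqP; split => x /=; rewrite !in_itv/= ltrBlDr lerBrDr.
rewrite !lebesgue_measure_itv/= !lte_fin ltrD2r.
by rewrite -!EFinB opprB addrA subrK.
Qed.

Definition rowvec_cons n (p : R * 'rV[R]_n) : 'rV[R]_n.+1 :=
  \row_i (if unlift ord0 i is Some j then p.2 ord0 j else p.1).

Lemma measurable_rowvec_cons n : measurable_fun setT (@rowvec_cons n).
Proof.
apply: measurable_fun_rowvecP => i; under eq_fun do rewrite mxE.
case: unlift => [j|]; last exact: measurable_fst.
by apply: (measurableT_comp (measurable_coord j)); exact: measurable_snd.
Qed.

Definition rectangle n (A : 'I_n -> set R) : set 'rV[R]_n :=
  [set x | forall i, A i (x ord0 i)].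

Lemma measurable_rectangle n (A : 'I_n -> set R) :
  (forall i, measurable (A i)) -> measurable (rectangle A).
Proof.
move=> mA.
rewrite (_ : rectangle A =
    \bigcap_(i in [set: 'I_n]) ((fun x : 'rV[R]_n => x ord0 i) @^-1` A i)).
  apply: fin_bigcap_measurable => [|i _]; first exact: finite_finset.
  by apply: measurable_preimageT => //; exact: measurable_coord.
apply/seteqP; split => x; first by move=> Ax i _; exact: Ax.
by move=> Ax i; exact: Ax.
Qed.

Lemma rectangle_cons n (A : 'I_n.+1 -> set R) :
  @rowvec_cons n @^-1` rectangle A =
  A ord0 `*` rectangle (fun j => A (lift ord0 j)).
Proof.
apply/seteqP; split => [[x y] Axy|[x y] [/= Ax Ay] i].
  split => [|j] /=; first by have := Axy ord0; rewrite mxE unlift_none.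
  by have := Axy (lift ord0 j); rewrite mxE liftK.
by rewrite mxE; case: unliftP => [j ->|->//]; exact: Ay.
Qed.

(** The measure in dimension n + 1 is the image of the product of the Lebesgue
    measure of the line with the measure in dimension n; the covering by
    centred cubes shows that it is sigma-finite. *)
Lemma exists_lebesgue_rowvec n :
  exists nu : {sigma_finite_measure set 'rV[R]_n -> \bar R},
  translation_invariant nu /\
  forall A : 'I_n -> set R, (forall i, measurable (A i)) ->
  nu (rectangle A) = \prod_(i < n) lebesgue_measure (A i).
Proof.
elim: n => [|n [nu [nuD nuX]]].
  exists (dirac (0%R : 'rV[R]_0)); split => [v A mA|A mA].
    by congr (dirac _ _); apply/seteqP; split => x /=;
      rewrite [(x + v)%R]thinmx0 [x]thinmx0.
  rewrite big_ord0 (_ : rectangle A = setT) ?[LHS]diracT//.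
  by apply/seteqP; split => x // _ [].
pose F (k : nat) : set 'rV[R]_n.+1 := rectangle (fun=> `[(- k%:R)%R, k%:R]%classic).
have mF k : measurable (F k) by exact: measurable_rectangle.
have FT : \bigcup_k F k = setT.
  apply/seteqP; split => x // _.
  exists (\sum_i Num.truncn `|x ord0 i|%R).+1 => // i /=.
  rewrite in_itv/= -ler_norml.
  rewrite (le_trans (ltW (truncnS_gt _)))// ler_nat ltnS.
  by rewrite (bigD1 i)//= leq_addr.
have Foo k : (lebesgue_measure \x nu)%E (@rowvec_cons n @^-1` F k) < +oo.
  have segoo :
      lebesgue_measure (`[(- k%:R)%R, k%:R]%classic : set R) < +oo :> \bar R.
    by rewrite lebesgue_measure_itv/=; case: ifP; rewrite ?ltry// -EFinB ltry.
  rewrite rectangle_cons [ltLHS]product_measure1E//; last first.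
    exact: measurable_rectangle.
  rewrite nuX//; apply: lte_mul_pinfty => //; rewrite ?ge0_fin_numE//.
  by rewrite ltey_eq prode_fin_num// => i _; rewrite ge0_fin_numE.
have [mu muE] := @pushforward_sigma_finite _ _
  (measurableTypeR R * 'rV[R]_n)%type _ R (lebesgue_measure \x nu)%E
  (@rowvec_cons n) (@measurable_rowvec_cons n) F FT mF Foo.
exists mu; split => [v A mA|A mA].
  pose v0 := v ord0 ord0; pose v1 := \row_j v ord0 (lift ord0 j).
  rewrite !muE -[RHS](@product_measure_preserving _ _ _ _ R lebesgue_measure nu
    (fun x => x + v0)%R (fun y => y + v1)%R).
  - congr ((_ \x _) _); apply/funext => -[x y] /=; congr A; apply/rowP => i.
    by rewrite !mxE; case: unliftP => [j ->|->//]; rewrite !mxE.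
  - exact: measurable_funD.
  - by move=> B mB; exact: lebesgue_measureD.
  - by move=> B mB; exact: nuD.
  - by apply: measurable_preimageT => //; exact: measurable_rowvec_cons.
rewrite muE rectangle_cons [LHS]product_measure1E ?nuX ?big_ord_recl//.
  exact: mA.
by apply: measurable_rectangle => j; exact: mA.
Qed.

Definition rowvec_lebesgue n : {sigma_finite_measure set 'rV[R]_n -> \bar R} :=
  sval (cid (exists_lebesgue_rowvec n)).

Lemma rowvec_lebesgueD n : translation_invariant (rowvec_lebesgue n).
Proof. exact: (svalP (cid (exists_lebesgue_rowvec n))).1. Qed.

Lemma rowvec_lebesgue_rectangle n (A : 'I_n -> set R) :
  (forall i, measurable (A i)) ->
  rowvec_lebesgue n (rectangle A) = \prod_(i < n) lebesgue_measure (A i).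
Proof. exact: (svalP (cid (exists_lebesgue_rowvec n))).2. Qed.

End lebesgue_rowvec.
Arguments rowvec_lebesgue {R} n.

(** * The outer measure defined by boxes *)

Section outer_measure.
Local Open Scope ereal_scope.
Context {R : realType} {n : nat}.
Local Notation mu := (@rowvec_lebesgue R n).
Implicit Types (A U : set 'rV[R]_n) (a b : 'rV[R]_n).

Definition half_open_box a b : set 'rV[R]_n :=
  rectangle (fun i => `[a ord0 i, b ord0 i[%classic).

Lemma measurable_half_open_box a b : measurable (half_open_box a b).
Proof. exact: measurable_rectangle. Qed.

Lemma boxE a b : box a b = rectangle (fun i => `[a ord0 i, b ord0 i]%classic).
Proof. by apply/seteqP; split => x /= xab i; have := xab i; rewrite /= in_itv. Qed.

Lemma measurable_box a b : measurable (box a b).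
Proof. by rewrite boxE; exact: measurable_rectangle. Qed.

Let lebesgue_itv (x y : R) c d : (x <= y)%R ->
  lebesgue_measure ([set` Interval (BSide c x) (BSide d y)] : set R) = (y - x)%:E.
Proof.
move=> xy; rewrite lebesgue_measure_itv/= lte_fin; case: ltP => [_|yx].
  by rewrite EFinB.
by have /eqP -> : x == y; [rewrite eq_le xy yx|rewrite subrr].
Qed.

Lemma rowvec_lebesgue_box a b : (forall i, a ord0 i <= b ord0 i)%R ->
  mu (box a b) = (box_vol a b)%:E.
Proof.
move=> ab; rewrite boxE rowvec_lebesgue_rectangle// /box_vol -prodEFin.
by apply: eq_bigr => i _; rewrite lebesgue_itv.
Qed.

Lemma rowvec_lebesgue_half_open_box a b : (forall i, a ord0 i <= b ord0 i)%R ->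
  mu (half_open_box a b) = (box_vol a b)%:E.
Proof.
move=> ab; rewrite rowvec_lebesgue_rectangle// /box_vol -prodEFin.
by apply: eq_bigr => i _; rewrite lebesgue_itv.
Qed.

Lemma box_vol_ge0 a b : (forall i, a ord0 i <= b ord0 i)%R -> (0 <= box_vol a b)%R.
Proof. by move=> ab; apply: prodr_ge0 => i _; rewrite subr_ge0. Qed.

Lemma rowvec_lebesgue_le_outer A : measurable A -> mu A <= lebesgue_outer A.
Proof.
move=> mA; apply: le_ereal_inf_tmp => _ [D [a [b [ab Aab ->]]]].
pose F k := if k \in D then box (a k) (b k) else set0.
have mF k : measurable (F k).
  by rewrite /F; case: ifP => // _; exact: measurable_box.
apply: (@le_trans _ _ (\sum_(k <oo) mu (F k))).
  apply: measure_sigma_subadditive => // x /Aab[k Dk xk].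
  by exists k => //; rewrite /F mem_set.
rewrite nneseries_esumT// [leRHS]esum_mkcond.
apply: le_esum => k _; rewrite /F; case: ifP => // _; last by rewrite measure0.
by rewrite rowvec_lebesgue_box.
Qed.

End outer_measure.

Section dyadic_cubes.
Local Open Scope ereal_scope.
Context {R : realType} {n : nat}.
Local Notation mu := (@rowvec_lebesgue R n).
Implicit Types (U : set 'rV[R]_n) (x y : 'rV[R]_n).

Definition dyadic_index k x : 'rV[int]_n :=
  \row_i Num.floor (x ord0 i * 2 ^+ k)%R.

Definition dyadic_corner k (z : 'rV[int]_n) (e : int) : 'rV[R]_n :=
  \row_i ((z ord0 i + e)%:~R / 2 ^+ k)%R.

Definition dyadic_cube k z := half_open_box (dyadic_corner k z 0) (dyadic_corner k z 1).

Lemma dyadic_cubeE k z : dyadic_cube k z = [set x | dyadic_index k x = z].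
Proof.
have p2 : (0 < 2 ^+ k :> R)%R by rewrite exprn_gt0.
apply/seteqP; split => x /= H.
  apply/rowP => i; have := H i; rewrite /= !mxE in_itv/= addr0.
  rewrite ler_pdivrMr// ltr_pdivlMr// => /andP[l u].
  by apply/floor_def; rewrite l.
move=> i; rewrite -H /= !mxE in_itv/= addr0 ler_pdivrMr// ltr_pdivlMr//.
exact: floor_itv.
Qed.

(** Two points in a common dyadic cube of side 2^-k lie in a common cube of every
    larger side: if 2a and 2b have the same integer part, so have a and b. *)
Lemma dyadic_index_nested j k x y : (j <= k)%N ->
  dyadic_index k x = dyadic_index k y -> dyadic_index j x = dyadic_index j y.
Proof.
move=> jk; rewrite -(subnK jk); elim: (k - j)%N => [//|m IH] xy; apply: IH.
have le u v : dyadic_index (m.+1 + j)%N u = dyadic_index (m.+1 + j)%N v ->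
    forall i, (dyadic_index (m + j)%N u ord0 i <= dyadic_index (m + j)%N v ord0 i)%R.
  move=> /rowP uv i; have := uv i; rewrite !mxE => uvi.
  have d2 w : (w ord0 i * 2 ^+ (m.+1 + j) = w ord0 i * 2 ^+ (m + j) * 2 :> R)%R.
    by rewrite addSn exprSr mulrA.
  move: uvi; rewrite !d2 floor_ge_int => uvi.
  rewrite -(ler_pM2r (ltr0Sn R 1)) -[X in (_ * X <= _)%R]/(2%:~R)%R -intrM.
  rewrite -floor_ge_int -uvi floor_ge_int intrM.
  by rewrite ler_pM2r// floor_le_tmp.
by apply/rowP => i; apply/eqP; rewrite eq_le !le.
Qed.

Lemma dyadic_cube_sub U x : open U -> U x ->
  exists k, `[< dyadic_cube k (dyadic_index k x) `<=` U >].
Proof.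
move=> oU Ux; have /nbhs_ballP[e /= e0 xeU] := open_nbhs_nbhs (conj oU Ux).
exists (Num.truncn e^-1).+1; apply/asboolP; set k := (Num.truncn e^-1).+1.
have ek : ((2 ^+ k)^-1 < e :> R)%R.
  rewrite invf_plt ?posrE ?exprn_gt0//.
  rewrite (lt_le_trans (truncnS_gt _))// -natrX ler_nat.
  exact/ltnW/ltn_expl.
rewrite dyadic_cubeE => y /= /rowP yx; apply: xeU; split => // i j; rewrite (ord1 i).
rewrite -ball_normE /=; have := yx j; rewrite !mxE => yxj.
apply: lt_trans ek.
have p2 : (0 < 2 ^+ k :> R)%R by rewrite exprn_gt0.
rewrite -(ltr_pM2r p2) mulVf ?gt_eqF// -{1}(gtr0_norm p2) -normrM mulrBl.
have := floor_itv (x ord0 j * 2 ^+ k)%R; have := floor_itv (y ord0 j * 2 ^+ k)%R.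
rewrite yxj intrD => /andP[a b] /andP[c d].
by rewrite ltr_norml; apply/andP; split; lra.
Qed.
End dyadic_cubes.

Section outer_open.
Local Open Scope ereal_scope.
Context {R : realType} {n : nat}.
Local Notation mu := (@rowvec_lebesgue R n).
Variables (U : set 'rV[R]_n) (oU : open U).

(* A cube is kept when it is contained in U and no larger dyadic cube around one
   of its points is; nestedness makes the kept cubes disjoint. *)
Let maximal (p : nat * 'rV[int]_n) : Prop :=
  dyadic_cube p.1 p.2 `<=` U /\ forall x : 'rV[R]_n, dyadic_cube p.1 p.2 x ->
    forall j, dyadic_cube j (dyadic_index j x) `<=` U -> (p.1 <= j)%N.

(* Cubes are enumerated through [pickle]; [pickle_inv], unlike [unpickle], gives
   every cube a single index. *)
Let D : set nat := [set m | if pickle_inv m is Some p then maximal p else False].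
Let corner (e : int) m : 'rV[R]_n := if @pickle_inv (nat * 'rV[int]_n)%type m is Some p
  then dyadic_corner p.1 p.2 e else 0%R.
Let F m : set 'rV[R]_n := half_open_box (corner 0 m) (corner 1 m).

Let UF : U = \bigcup_(m in D) F m.
Proof.
apply/seteqP; split => x; last first.
  move=> [m]; rewrite /D /F /corner/=; case: pickle_inv => // -[k z] [/= kU _].
  exact: kU.
move=> Ux; have ex := dyadic_cube_sub oU Ux.
case: (ex_minnP ex) => k /asboolP kU kmin.
exists (pickle (k, dyadic_index k x)); last first.
  rewrite /F /corner pickleK_inv/=.
  by rewrite -[X in X _]/(dyadic_cube _ _) dyadic_cubeE.
rewrite /D/= pickleK_inv; split => // y /=; rewrite dyadic_cubeE/= => yx j jU.
rewrite leqNgt; apply/negP => jk.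
have := kmin j; rewrite leqNgt jk => /(_ _)/notF; apply.
by apply/asboolP; rewrite -(dyadic_index_nested (ltnW jk) yx).
Qed.

Let tF : trivIset D F.
Proof.
move=> i j; rewrite /D /F /corner/=.
case Ei : pickle_inv => [[k z]|//] []; rewrite /= => zU zmin.
case Ej : pickle_inv => [[l w]|//] []; rewrite /= => wU wmin.
move=> [x [xz xw]].
have {}xz : dyadic_cube k z x by [].
have {}xw : dyadic_cube l w x by [].
have xk : dyadic_index k x = z by move: xz; rewrite dyadic_cubeE.
have xl : dyadic_index l x = w by move: xw; rewrite dyadic_cubeE.
have kl : k = l.
  by apply/eqP; rewrite eqn_leq (zmin _ xz) ?xl// (wmin _ xw) ?xk.
have zw : z = w by rewrite -xk -xl kl.
have := @pickle_invK (nat * 'rV[int]_n)%type i.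
have := @pickle_invK (nat * 'rV[int]_n)%type j; rewrite Ei Ej /= kl zw => <- <-.
by [].
Qed.

Lemma open_measurable_rowvec : measurable U.
Proof.
by rewrite UF; apply: bigcup_measurable => m _; exact: measurable_half_open_box.
Qed.

(** The closures of the disjoint half-open cubes form a cover of U by boxes of the
    same total volume. *)
Lemma outer_le_rowvec_lebesgue : lebesgue_outer U <= mu U.
Proof.
apply: ereal_inf_lbound.
have le01 m i : (corner 0 m ord0 i <= corner 1 m ord0 i)%R.
  rewrite /corner; case: pickle_inv => [p|//]; rewrite !mxE.
  by rewrite ler_pM2r ?invr_gt0 ?exprn_gt0// ler_int lerD2l.
exists D, (corner 0), (corner 1); split => //.
  rewrite UF => x [m Dm xm]; exists m => // i.
  by have := xm i; rewrite /= in_itv/= => /andP[-> /ltW].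
rewrite [in LHS]UF measure_bigcup//; last first.
  by move=> m _; exact: measurable_half_open_box.
rewrite nneseries_esum//.
rewrite set_mem_set; apply: eq_esum => m _.
exact: rowvec_lebesgue_half_open_box.
Qed.
End outer_open.

Section outer_null.
Local Open Scope ereal_scope.
Context {R : realType} {n : nat}.
Implicit Types (A N : set 'rV[R]_n).

Lemma le_lebesgue_outer A B : A `<=` B -> lebesgue_outer A <= lebesgue_outer B.
Proof.
move=> AB; apply: ereal_inf_le_tmp => _ [D [a [b [ab Bab ->]]]].
by exists D, a, b; split => //; exact: subset_trans Bab.
Qed.

(** Two covers are merged by using the even and the odd indices. *)
Lemma lebesgue_outerU_null A N : lebesgue_outer N = 0 ->
  lebesgue_outer (A `|` N) <= lebesgue_outer A.
Proof.
move=> N0; apply: le_ereal_inf_tmp => _ [D1 [a1 [b1 [ab1 Aab ->]]]].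
apply/lee_addgt0Pr => e e0.
have : lebesgue_outer N < e%:E by rewrite N0 lte_fin.
move=> /ereal_inf_lt[_ [D2 [a2 [b2 [ab2 Nab ->]]]]] lte.
apply: (@le_trans _ _ (\esum_(k in D1) (box_vol (a1 k) (b1 k))%:E +
   \esum_(k in D2) (box_vol (a2 k) (b2 k))%:E)); last by rewrite leeD2l// ltW.
pose sel T (u v : nat -> T) m := if odd m then v m./2 else u m./2.
pose even_ k := k.*2; pose odd_ k := k.*2.+1.
have sel_even T (u v : nat -> T) k : sel _ u v (even_ k) = u k.
  by rewrite /sel odd_double doubleK.
have sel_odd T (u v : nat -> T) k : sel _ u v (odd_ k) = v k.
  by rewrite /sel /= odd_double /= uphalf_double.
apply: ereal_inf_lbound.
exists (even_ @` D1 `|` odd_ @` D2), (sel _ a1 a2), (sel _ b1 b2); split.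
- by move=> m i; rewrite /sel; case: ifP.
- move=> x [/Aab|/Nab] [k Dk xk].
    by exists (even_ k); [left; exists k|rewrite !sel_even].
  by exists (odd_ k); [right; exists k|rewrite !sel_odd].
have ge0 m : 0 <= (box_vol (sel _ a1 a2 m) (sel _ b1 b2 m))%:E.
  by rewrite lee_fin box_vol_ge0// => i; rewrite /sel; case: ifP.
rewrite [RHS](esumID (even_ @` D1))//; congr (_ + _)%E.
  rewrite [in RHS](_ : _ `&` _ = even_ @` D1); last first.
    by apply/seteqP; split => [m []|m Dm] //; split => //; left.
  rewrite esum_image; first by apply: eq_esum => k _; rewrite !sel_even.
  by move=> k l _ _ /double_inj.
rewrite (_ : _ `&` _ = odd_ @` D2).
  rewrite esum_image; first by apply: eq_esum => k _; rewrite !sel_odd.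
  by move=> k l _ _ [] /double_inj.
apply/seteqP; split => m [].
  by case.
move=> k Dk <-; split; first by right; exists k.
by case=> l _ /(congr1 odd); rewrite /= !odd_double.
Qed.

End outer_null.

(** * Linear images of Lebesgue measure *)

Lemma muleI (R : realType) (a x y : \bar R) : (0 < a < +oo)%E ->
  (a * x = a * y)%E -> x = y.
Proof.
case: a => [a||]; rewrite ?ltxx ?andbF// lte_fin => /andP[a0 _] axy.
have K z : z = ((a^-1)%:E * (a%:E * z))%E.
  by rewrite muleA -EFinM mulVf ?gt_eqF// mul1e.
by rewrite [x]K axy -K.
Qed.

Section linear_images.
Local Open Scope ereal_scope.
Context {R : realType}.
Local Notation mu := (@rowvec_lebesgue R _).

Definition cube n (s : R) : set 'rV[R]_n := box (const_mx (- s)%R) (const_mx s).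

Lemma measurable_cube n s : measurable (@cube n s).
Proof. exact: measurable_box. Qed.

Lemma cubeE n s : @cube n s = [set x | forall i, (`|x ord0 i| <= s)%R].
Proof. by apply/seteqP; split=> x xs i; have := xs i; rewrite !mxE ler_norml. Qed.

Lemma rowvec_lebesgue_cube n (s : R) : (0 <= s)%R ->
  mu (@cube n s) = ((s *+ 2) ^+ n)%:E.
Proof.
move=> s0; rewrite rowvec_lebesgue_box => [|i].
  rewrite /box_vol; under eq_bigr do rewrite !mxE opprK -mulr2n.
  by rewrite prodr_const card_ord.
by rewrite !mxE (le_trans _ s0)// oppr_le0.
Qed.

Lemma bigcup_cube n : \bigcup_k @cube n k%:R = setT.
Proof.
apply/seteqP; split => x // _.
exists (\sum_i Num.truncn `|x ord0 i|%R).+1 => //; rewrite cubeE => i /=.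
rewrite (le_trans (ltW (truncnS_gt _)))// ler_nat ltnS.
by rewrite (bigD1 i)//= leq_addr.
Qed.

(** The image of Lebesgue measure under an invertible linear map is translation
    invariant, hence proportional to Lebesgue measure. *)
Lemma rowvec_lebesgue_linear n (L : 'M[R]_n) (A B : set 'rV[R]_n) :
  L \in unitmx -> measurable A -> measurable B ->
  mu A * mu [set y | B (y *m L)] = mu [set y | A (- (y *m L))%R] * mu B.
Proof.
move=> uL mA mB.
pose F k := (fun x => x *m invmx L) @^-1` @cube n k%:R.
have mF k : measurable (F k).
  by apply: measurable_preimageT; [exact: measurable_mulmxr|exact: measurable_cube].
have FT : \bigcup_k F k = setT by rewrite -preimage_bigcup bigcup_cube preimage_setT.
have fF k : (fun y => y *m L) @^-1` F k = @cube n k%:R.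
  by apply/seteqP; split => y; rewrite /F/= mulmxK.
have Foo k : mu ((fun y => y *m L) @^-1` F k) < +oo.
  by rewrite fF rowvec_lebesgue_cube ?ltry.
have [nu nuE] := @pushforward_sigma_finite _ _ _ _ R mu (fun y => y *m L)
  (measurable_mulmxr L) F FT mF Foo.
rewrite -[X in mu A * X]nuE (translation_invariant_unique _ _ mA mB).
- by rewrite nuE.
- exact: rowvec_lebesgueD.
- move=> v S mS; rewrite !nuE.
  have mLS : measurable [set y | S (y *m L)].
    by apply: measurable_preimageT mS; exact: measurable_mulmxr.
  rewrite -[RHS](rowvec_lebesgueD (v *m invmx L) mLS).
  by congr (rowvec_lebesgue _ _); apply/seteqP; split => y /=;
    rewrite mulmxDl mulmxKV.
Qed.

(** The ratio is read off from a centred cube, whose preimage is again such a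
    cube. *)
Lemma rowvec_lebesgue_scale n (s : R) (B : set 'rV[R]_n) :
  (0 < s)%R -> measurable B ->
  mu [set y | B (s *: y)%R] = ((s^-1) ^+ n)%:E * mu B.
Proof.
move=> s0 mB.
have us : (s%:M : 'M[R]_n) \in unitmx.
  by rewrite unitmxE det_scalar unitfE expf_neq0// gt_eqF.
have := rowvec_lebesgue_linear us (measurable_cube 1) mB.
have -> : [set y | B (y *m s%:M)] = [set y | B (s *: y)%R].
  by apply/seteqP; split => y /=; rewrite mul_mx_scalar.
have -> : [set y : 'rV[R]_n | cube 1 (- (y *m s%:M))%R] = cube s^-1.
  rewrite !cubeE; apply/seteqP; split => y /= ys i; have := ys i;
  rewrite mul_mx_scalar !mxE normrN normrM (gtr0_norm s0) mulrC;
  by rewrite -ler_pdivlMr// div1r.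
rewrite !rowvec_lebesgue_cube ?invr_ge0 ?ltW//.
rewrite -[in RHS]mulr_natr exprMn mulrC EFinM -muleA; apply: muleI.
by rewrite lte_fin ltry exprn_gt0.
Qed.

Lemma rowvec_lebesgue_ball n :
  0 < mu (@euclidean_ball R n) < +oo.
Proof.
have mb := @measurable_euclidean_ball R n.
have dotpE (x : 'rV[R]_n) : dotp x x = (\sum_i x ord0 i ^+ 2)%R.
  by rewrite /dotp mxE; apply: eq_bigr => i _; rewrite mxE expr2.
apply/andP; split.
  apply: (@lt_le_trans _ _ (mu (@cube n (n.+1%:R^-1)))).
    by rewrite rowvec_lebesgue_cube// lte_fin exprn_gt0// pmulrn_lgt0.
  apply: le_measure; rewrite ?inE//; first exact: measurable_cube.
  rewrite cubeE => x /= xn; rewrite /euclidean_ball /= dotpE.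
  apply: (@le_trans _ _ (\sum_(i < n) n.+1%:R^-1)%R).
    apply: ler_sum => i _; rewrite -real_normK ?num_real// expr2.
    apply: (le_trans (ler_pM _ _ (xn i) (xn i))) => //.
    by rewrite ger_pMl ?invr_gt0// invf_le1 ?ler1n.
  rewrite sumr_const card_ord -[X in (X <= _)%R]mulr_natl ler_pdivrMr// mul1r.
  by rewrite ler_nat.
apply: (@le_lt_trans _ _ (mu (@cube n 1))).
  apply: le_measure; rewrite ?inE//; first exact: measurable_cube.
  rewrite cubeE => x; rewrite /euclidean_ball /= dotpE => x1 i.
  rewrite -(@expr_le1 _ 2)// real_normK ?num_real//.
  apply: le_trans x1; rewrite (bigD1 i)//= lerDl.
  by apply: sumr_ge0 => j _; exact: sqr_ge0.
by rewrite rowvec_lebesgue_cube// ltry.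
Qed.

(** The unit ball is its own preimage, so the factor of proportionality is 1. *)
Lemma rowvec_lebesgue_orthogonal n (Q : 'M[R]_n) (B : set 'rV[R]_n) :
  Q *m Q^T = 1%:M -> measurable B -> mu [set y | B (y *m Q)] = mu B.
Proof.
move=> QQ mB.
have uQ : Q \in unitmx by case/mulmx1_unit: QQ.
have := rowvec_lebesgue_linear uQ (@measurable_euclidean_ball R n) mB.
have -> : [set y | euclidean_ball (- (y *m Q))%R] = @euclidean_ball R n.
  apply/seteqP; split => y; rewrite /euclidean_ball/= /dotp;
  by rewrite linearN/= mulNmx mulmxN opprK trmx_mul mulmxA -(mulmxA y) QQ mulmx1.
exact/muleI/rowvec_lebesgue_ball.
Qed.

(** Uniqueness is applied to the ellipsoid itself, whose preimage is the unit
    ball; this gives the factor of proportionality as a ratio of volumes in place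
    of a determinant. *)
Lemma rowvec_lebesgue_affine_ball n (c : 'rV[R]_n) (L : 'M[R]_n)
    (U : set 'rV[R]_n) : L \in unitmx -> measurable U ->
  mu [set (c + y *m L)%R | y in euclidean_ball] * mu [set w | U (c + w *m L)%R] =
  mu (@euclidean_ball R n) * mu U.
Proof.
move=> uL mU.
pose A := [set x : 'rV[R]_n | euclidean_ball (x *m invmx L)].
have mA : measurable A.
  apply: (measurable_preimageT (measurable_mulmxr _)).
  exact: measurable_euclidean_ball.
have mUc : measurable [set x | U (x + c)%R].
  suff mc : measurable_fun setT (fun x : 'rV[R]_n => x + c)%R.
    exact: (measurable_preimageT mc mU).
  by apply: (@measurable_rowvecD _ _ _ _ id (cst c)).
have := rowvec_lebesgue_linear uL mA mUc.
rewrite (rowvec_lebesgueD c mU) -(rowvec_lebesgueD (- c)%R mA).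
have -> : [set x | A (x - c)%R] = [set (c + y *m L)%R | y in euclidean_ball].
  apply/seteqP; split => [x /= Ax|_ [y yB <-]].
    by exists ((x - c) *m invmx L)%R => //; rewrite mulmxKV// addrC subrK.
  by rewrite /A/= addrC addKr mulmxK.
have -> : [set y | A (- (y *m L))%R] = @euclidean_ball R n.
  apply/seteqP; split => y; rewrite /A/= mulNmx mulmxK// /euclidean_ball /= /dotp;
  by rewrite linearN/= mulNmx mulmxN opprK.
have -> // : [set y | [set x | U (x + c)%R] (y *m L)] = [set w | U (c + w *m L)%R].
by apply/seteqP; split => y /=; rewrite addrC.
Qed.

End linear_images.

(** * Archimedes' theorem *)

Section fubini_rowvec.
Local Open Scope ereal_scope.
Context {R : realType}.
Local Notation mu := (@rowvec_lebesgue R _).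

Definition row_pair m n (p : 'rV[R]_m * 'rV[R]_n) : 'rV[R]_(m + n) :=
  row_mx p.1 p.2.

Lemma measurable_row_pair m n : measurable_fun setT (@row_pair m n).
Proof. by apply: measurable_row_mx. Qed.

Lemma row_pair_cube m n (s : R) :
  @row_pair m n @^-1` cube s = cube s `*` cube s.
Proof.
rewrite !cubeE; apply/seteqP; split => [[x y] /= xys|[x y] [/= xs ys] i].
  split => i; first by have := xys (lshift n i); rewrite row_mxEl.
  by have := xys (rshift m i); rewrite row_mxEr.
by rewrite /row_pair/= mxE; case: fintype.split => j; [exact: xs|exact: ys].
Qed.

(** The product measure is translation invariant, and it agrees with Lebesgue
    measure on centred cubes. *)
Lemma rowvec_lebesgue_row_pair m n (S : set 'rV[R]_(m + n)) : measurable S ->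
  mu S = (@rowvec_lebesgue R m \x @rowvec_lebesgue R n) (@row_pair m n @^-1` S).
Proof.
move=> mS.
have pc (s : R) : (0 <= s)%R -> (@rowvec_lebesgue R m \x @rowvec_lebesgue R n)
    (@row_pair m n @^-1` cube s) = ((s *+ 2) ^+ (m + n))%:E.
  move=> s0; rewrite row_pair_cube product_measure1E; [|exact: measurable_cube..].
  by rewrite exprD EFinM; congr (_ * _); exact: rowvec_lebesgue_cube.
have Foo k : (@rowvec_lebesgue R m \x @rowvec_lebesgue R n)
    (@row_pair m n @^-1` cube k%:R) < +oo by rewrite pc ?ltry.
have [nu nuE] := @pushforward_sigma_finite _ _ _ _ R
  (@rowvec_lebesgue R m \x @rowvec_lebesgue R n)%E (@row_pair m n)
  (@measurable_row_pair m n) (fun k => cube k%:R) (@bigcup_cube R _)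
  (fun=> measurable_cube _) Foo.
have nuD : translation_invariant nu.
  move=> v A mA; rewrite !nuE.
  rewrite -[RHS](@product_measure_preserving _ _ _ _ R
    (rowvec_lebesgue m) (rowvec_lebesgue n)
    (fun x => x + lsubmx v)%R (fun y => y + rsubmx v)%R).
  - congr ((_ \x _) _); apply/funext => -[x y] /=; congr A.
    by rewrite /row_pair/= -add_row_mx hsubmxK.
  - by apply: (@measurable_rowvecD _ _ _ _ id (cst _)).
  - by move=> B mB; exact: rowvec_lebesgueD.
  - by move=> B mB; exact: rowvec_lebesgueD.
  - by apply: measurable_preimageT => //; exact: measurable_row_pair.
have := translation_invariant_unique nuD (@rowvec_lebesgueD R _)
  (@measurable_cube R _ 1) mS.
have -> : [set x : 'rV[R]_(m + n) | cube 1 (- x)%R] = cube 1.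
  by rewrite !cubeE; apply/seteqP; split => x /= x1 i; have := x1 i; rewrite mxE normrN.
rewrite (etrans (nuE _) (pc _ ler01)) rowvec_lebesgue_cube// => /muleI-> //.
by rewrite lte_fin ltry exprn_gt0.
Qed.

End fubini_rowvec.

Section plane.
Local Open Scope ereal_scope.
Context {R : realType}.
Local Notation mu := (@rowvec_lebesgue R _).
Local Notation leb := (@lebesgue_measure R).

Lemma dotpE n (x y : 'rV[R]_n) : dotp x y = (\sum_i x ord0 i * y ord0 i)%R.
Proof. by rewrite /dotp mxE; apply: eq_bigr => i _; rewrite mxE. Qed.

Lemma dotp_ge0 n (x : 'rV[R]_n) : (0 <= dotp x x)%R.
Proof. by rewrite dotpE; apply: sumr_ge0 => i _; rewrite -expr2 sqr_ge0. Qed.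

Lemma dotp_eq0 n (x : 'rV[R]_n) : (dotp x x == 0)%R = (x == 0%R).
Proof.
rewrite dotpE psumr_eq0 => [|i _]; last by rewrite -expr2 sqr_ge0.
apply/allP/eqP => [x0|-> i _]; last by rewrite /= mxE mul0r eqxx.
apply/rowP => i; rewrite mxE; apply/eqP.
by have := x0 i (mem_index_enum _); rewrite mulf_eq0 orbb.
Qed.

Lemma dotpZ n (s : R) (x : 'rV[R]_n) :
  dotp (s *: x)%R (s *: x)%R = (s ^+ 2 * dotp x x)%R.
Proof.
by rewrite !dotpE big_distrr/=; apply: eq_bigr => i _; rewrite !mxE expr2 mulrACA.
Qed.

Lemma dotp_row_mx m n (x : 'rV[R]_m) (y : 'rV[R]_n) :
  dotp (row_mx x y) (row_mx x y) = (dotp x x + dotp y y)%R.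
Proof. by rewrite /dotp tr_row_mx mul_row_col mxE. Qed.

Lemma measurable_lt_set d (T : measurableType d) (f g : T -> R) :
  measurable_fun setT f -> measurable_fun setT g ->
  measurable [set t | (f t < g t)%R].
Proof.
move=> mf mg; rewrite -[X in measurable X]setTI.
by apply: (measurable_fun_ltr mf mg measurableT (_ : measurable [set true])).
Qed.

Lemma measurable_sqnorm n : measurable_fun setT (fun x : 'rV[R]_n => dotp x x).
Proof. by apply: measurable_dotp; exact: measurable_id. Qed.

Definition open_disc_area := mu [set z : 'rV[R]_2 | (dotp z z < 1)%R].

Let measurable_disc (x : R) : measurable [set z : 'rV[R]_2 | (dotp z z < x)%R].
Proof. by apply: measurable_lt_set => //; exact: measurable_sqnorm. Qed.

(** In dimension k the exponent of s would be k / 2; only for k = 2 is the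
    squared norm uniformly distributed, which is why the theorem is about
    2-dimensional directions. *)
Lemma disc_area (s : R) : (0 < s)%R ->
  mu [set z : 'rV[R]_2 | (dotp z z < s)%R] = s%:E * open_disc_area.
Proof.
move=> s0; pose t := (s `^ 2^-1)%R.
have t0 : (0 < t)%R by rewrite powR_gt0.
have tt : (t ^+ 2 = s)%R.
  by rewrite -powR_mulrn ?ltW// -powRrM mulVf// powRr1// ltW.
have := @rowvec_lebesgue_scale R 2 t^-1 _ _ (measurable_disc 1).
rewrite invr_gt0 t0 invrK tt => /(_ isT) <-; congr (mu _).
apply/seteqP; split => z /=; rewrite dotpZ exprVn tt;
by rewrite mulrC ltr_pdivrMr// mul1r.
Qed.

Lemma open_disc_area_fin : open_disc_area < +oo.
Proof.
have /andP[_] := rowvec_lebesgue_ball (R := R) 2; apply: le_lt_trans.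
apply: le_measure; rewrite ?inE.
- exact: measurable_disc.
- exact: measurable_euclidean_ball.
- by move=> z /= /ltW.
Qed.

(** Both sides are measures in B, so it suffices to compare them on the half-lines
    ]-oo, x[, where the left-hand side is the area of a disc. *)
Lemma rowvec_lebesgue_sqnorm (B : set R) : measurable B ->
  mu [set z : 'rV[R]_2 | B (dotp z z)] =
  open_disc_area * leb (B `&` `[0%R, +oo[%classic).
Proof.
move=> mB.
have d0 : 0 <= open_disc_area by exact: measure_ge0.
have c0 : (0 <= fine open_disc_area)%R by exact: fine_ge0.
have cE : open_disc_area = (fine open_disc_area)%:E.
  by rewrite fineK// ge0_fin_numE// open_disc_area_fin.
have m0 : measurable (`[0%R, +oo[%classic : set (measurableTypeR R)) by [].
pose m2 : {measure set (measurableTypeR R) -> \bar R} :=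
  mscale (NngNum c0) (mrestr leb m0).
have [m1 m1E] : exists m1 : {measure set (measurableTypeR R) -> \bar R},
    forall A, m1 A = mu [set z : 'rV[R]_2 | A (dotp z z)].
  by unshelve eexists (pushforward mu
    ((fun z => dotp z z) : 'rV[R]_2 -> measurableTypeR R)
    : {measure set (measurableTypeR R) -> \bar R}) => //; exact: measurable_sqnorm.
have m2E A : m2 A = open_disc_area * leb (A `&` `[0%R, +oo[%classic) by rewrite cE.
rewrite -m1E -m2E.
have m12 (x : R) : m1 `]-oo, x[%classic = m2 `]-oo, x[%classic.
  rewrite m1E m2E (_ : _ `&` _ = `[0%R, x[%classic); last first.
    apply/seteqP; split => t /=; rewrite !in_itv/= andbT => /andP.
      by rewrite andbC.
    by case=> -> ->.
  rewrite lebesgue_measure_itv/= lte_fin sube0.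
  case: ltP => x0; last first.
    rewrite mule0 (_ : [set z | _] = set0) ?measure0//.
    apply/seteqP; split => z //=; rewrite in_itv/= => zx.
    by have := dotp_ge0 z; rewrite leNgt (lt_le_trans zx).
  rewrite muleC -disc_area//; congr (mu _).
apply: (@measure_unique _ R (measurableTypeR R) (@RGenInftyO.G R)
  (fun k => `]-oo, k%:R[%classic)) => //.
- exact: RGenInftyO.measurableE.
- move=> _ _ [x ->] [y ->]; exists (Num.min x y).
  by apply/seteqP; split => z /=; rewrite !in_itv/= lt_min => /andP.
- by move=> k; exists k%:R.
- apply/seteqP; split => x // _; exists (Num.truncn `|x|).+1 => //=.
  by rewrite in_itv/= (le_lt_trans (ler_norm _) (truncnS_gt _)).
- by move=> _ [x ->].
- move=> k; rewrite m1E; apply: le_lt_trans (_ : k.+1%:R%:E * open_disc_area < +oo).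
    rewrite -disc_area//; apply: le_measure; rewrite ?inE.
    + exact: measurable_disc.
    + exact: measurable_disc.
    + by move=> z /=; rewrite in_itv/= => /lt_le_trans; apply; rewrite ler_nat.
  by rewrite cE -EFinM ltry.
Qed.
End plane.

Section archimedes.
Local Open Scope ereal_scope.
Context {R : realType}.
Local Notation mu := (@rowvec_lebesgue R _).
Local Notation leb := (@lebesgue_measure R).

(** The inverse norm is written as a power, whose value at 0 is 0; the centre is
    thus mapped to itself. *)
Definition sphere_proj n (x : 'rV[R]_n) : 'rV[R]_n :=
  (dotp x x `^ (- 2^-1) *: x)%R.

Lemma measurable_sphere_proj n : measurable_fun setT (@sphere_proj n).
Proof.
apply: measurable_rowvecZ; last exact: measurable_id.
exact: (measurableT_comp (measurable_powR (- 2^-1)%R) (@measurable_sqnorm R n)).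
Qed.

Lemma powRN_half (t : R) : (t `^ (- 2^-1) = (t `^ 2^-1)^-1)%R.
Proof. exact: powRN. Qed.

Lemma sqr_powR_half (t : R) : (0 <= t)%R -> ((t `^ 2^-1) ^+ 2 = t)%R.
Proof. by move=> t0; rewrite -powR_mulrn ?powR_ge0// -powRrM mulVf// powRr1. Qed.

Lemma sphere_proj_dotp n (x : 'rV[R]_n) : x != 0%R ->
  dotp (sphere_proj x) (sphere_proj x) = 1%R.
Proof.
rewrite -dotp_eq0 => x0.
by rewrite dotpZ powRN_half exprVn sqr_powR_half ?dotp_ge0// mulVf.
Qed.

Lemma cube0 n : cube 0 = [set (0%R : 'rV[R]_n)].
Proof.
rewrite cubeE; apply/seteqP; split => x /= => [x0|-> i]; last by rewrite mxE normr0.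
by apply/rowP => i; rewrite mxE; apply/eqP; rewrite -normr_le0.
Qed.

Lemma rowvec_lebesgue_set0 n : mu [set (0%R : 'rV[R]_n.+1)] = 0.
Proof. by rewrite -cube0 rowvec_lebesgue_cube// mul0rn expr0n. Qed.

(** The dimension of U is positive because the origin has to be negligible: at
    t = 0 the section of W may be reduced to it. *)
Theorem archimedes n : exists K : \bar R,
  forall U : set 'rV[R]_n.+1, measurable U -> U `<=` euclidean_ball ->
  mu [set x : 'rV[R]_(n.+1 + 2) | euclidean_ball x /\ U (lsubmx (sphere_proj x))]
  = K * mu U.
Proof.
pose h (t : R) := (\1_(`]0%R, 1%R]%classic : set R) t * (t `^ 2^-1) ^+ n.+1)%R.
have mh : measurable_fun setT h.
  apply: measurable_funM; first exact: measurable_indic.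
  by apply: measurable_funX; exact: measurable_powR.
have h0 t : (0 <= h t)%R by rewrite mulr_ge0// exprn_ge0 ?powR_ge0.
exists (@open_disc_area R * \int[leb]_t (h t)%:E) => U mU U1.
(* W is the set of (y, t) with t = |y|^2 + |z|^2 for some admissible z; the
   condition |y|^2 <= t expresses that |z|^2 is nonnegative. *)
pose W := [set p : 'rV[R]_n.+1 * R |
  ((dotp p.1 p.1 <= p.2)%R /\ (p.2 <= 1)%R) /\ U (p.2 `^ (- 2^-1) *: p.1)%R].
have mW : measurable (W : set ('rV[R]_n.+1 * measurableTypeR R)).
  apply: measurableI; first apply: measurableI.
  - apply: measurable_le_set => //.
    by apply: (measurableT_comp (@measurable_sqnorm R n.+1)).
  - by apply: measurable_le_set.
  - apply: (@measurable_preimageT _ _ _ _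
      (fun p : 'rV[R]_n.+1 * R => p.2 `^ (- 2^-1) *: p.1)%R) => //.
    apply: measurable_rowvecZ => //.
    exact: (measurableT_comp (measurable_powR (- 2^-1)%R) measurable_snd).
pose S := [set x : 'rV[R]_(n.+1 + 2) |
  euclidean_ball x /\ U (lsubmx (sphere_proj x))].
have mS : measurable S.
  apply: measurableI; first exact: measurable_euclidean_ball.
  apply: (@measurable_preimageT _ _ _ _ (lsubmx \o @sphere_proj _)) => //.
  apply: measurableT_comp; first exact: measurable_lsubmx.
  exact: measurable_sphere_proj.
rewrite -[X in mu X]/S rowvec_lebesgue_row_pair//.
transitivity (\int[mu]_y (@open_disc_area R * leb (xsection W y))).
  apply: eq_integral => y _ /=.
  have mWy : measurable [set s : R | xsection W y (s + dotp y y)%R].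
    have ms : measurable_fun setT (fun s : R => s + dotp y y)%R.
      by apply: measurable_funD.
    by apply: (measurable_preimageT ms); exact: measurable_xsection.
  rewrite -(lebesgue_measureD (dotp y y)); last exact: measurable_xsection.
  have -> : [set s : R | xsection W y (s + dotp y y)%R] =
            [set s : R | xsection W y (s + dotp y y)%R] `&` `[0%R, +oo[%classic.
    apply/seteqP; split => s; last by case.
    move=> /= ys; split => //; rewrite in_itv/= andbT.
    by move: ys => /set_mem[[/=]]; rewrite lerDr.
  rewrite -rowvec_lebesgue_sqnorm//; congr (rowvec_lebesgue _ _).
  apply/seteqP; split => z.
    move=> /set_mem; rewrite /S /= /row_pair/= => -[].
    rewrite /euclidean_ball /sphere_proj /= dotp_row_mx => yz1.
    rewrite scale_row_mx row_mxKl => Uy.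
    by apply/mem_set; rewrite /W /= addrC lerDl dotp_ge0.
  move=> /set_mem; rewrite /W /= => -[[_ yz1] Uy]; apply/mem_set.
  rewrite /row_pair/= /S /= /euclidean_ball /= /sphere_proj dotp_row_mx addrC.
  by split => //; rewrite scale_row_mx row_mxKl.
rewrite ge0_integralZl//; last first.
  exact: (measurable_fun_xsection leb mW).
rewrite -[in LHS]/((mu \x leb) W) product_measure12// -muleA; congr (_ * _).
rewrite -ge0_integralZr//; last 2 first.
  exact/measurable_EFinP.
  by move=> t _; rewrite lee_fin.
(* For 0 < t <= 1 the inequality |y|^2 <= t holds for y / sqrt t in U, because U
   is contained in the unit ball. *)
apply: eq_integral => t _ /=; rewrite /h indicE.
have [/set_mem|/negP t01] := boolP (t \in _).
  rewrite /= in_itv/= => /andP[t0 t1]; rewrite mul1r.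
  have r0 : (0 < t `^ 2^-1)%R by rewrite powR_gt0.
  rewrite -[in RHS](invrK (t `^ 2^-1))%R -rowvec_lebesgue_scale ?invr_gt0//.
  congr (rowvec_lebesgue _ _); apply/seteqP; split => y.
    by move=> /set_mem[_ /=]; rewrite powRN_half.
  move=> /= Uy; apply/mem_set; rewrite /W /= t1 powRN_half; split => //; split => //.
  have := U1 _ Uy; rewrite /euclidean_ball/= dotpZ exprVn (sqr_powR_half (ltW t0)).
  by rewrite mulrC ler_pdivrMr// mul1r.
rewrite mul0r mul0e; apply/eqP; rewrite -measure_le0.
rewrite -(rowvec_lebesgue_set0 n); apply: le_measure; rewrite ?inE.
- exact: measurable_ysection.
- by rewrite -cube0; exact: measurable_cube.
move=> y /set_mem[[/= yt t1] _]; apply/eqP; rewrite -dotp_eq0.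
rewrite eq_le dotp_ge0 andbT (le_trans yt)// leNgt; apply/negP => t0.
by apply: t01; rewrite inE /= in_itv/= t0.
Qed.
End archimedes.

(** * Orthonormal bases *)

Section orthonormal_bases.
Context {R : realType}.

Lemma orthonormal_row_free n d (U : 'M[R]_(n, d)) : U *m U^T = 1%:M -> row_free U.
Proof. by move=> UU; apply/row_freeP; exists U^T. Qed.

Lemma gram_schmidt n d (B : 'M[R]_(n, d)) : row_free B ->
  exists U : 'M[R]_(n, d), U *m U^T = 1%:M /\ (U :=: B)%MS.
Proof.
elim: n B => [|n IH] B fB.
  by exists B; split => //; apply/matrixP => -[].
pose v : 'rV[R]_d := usubmx (B : 'M[R]_(1 + n, d)).
pose B' : 'M[R]_(n, d) := dsubmx (B : 'M[R]_(1 + n, d)).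
have eB : (v + B' :=: B)%MS.
  by apply: eqmx_trans (addsmxE v B') _; rewrite vsubmxK.
have fB' : row_free B'.
  rewrite /row_free eqn_leq rank_leq_row /= -(leq_add2l 1).
  move: fB; rewrite /row_free => /eqP rB.
  rewrite add1n -{1}rB -eB.
  by rewrite (leq_trans (mxrank_adds_leqif _ _))// leq_add2r rank_leq_row.
have [U' [UU' eU']] := IH _ fB'.
pose w := v - v *m U'^T *m U'.
have wU' : w *m U'^T = 0 by rewrite mulmxBl -!mulmxA UU' mulmx1 subrr.
have w0 : w != 0.
  apply/eqP => /eqP; rewrite subr_eq0 => /eqP vE.
  have : (v <= B')%MS by rewrite -eU' vE submxMl.
  move=> vB'; have : \rank B = \rank B'.
    by rewrite -eB; apply/eqmx_rank/eqmxP/addsmx_idPr.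
  by move: fB fB'; rewrite /row_free => /eqP -> /eqP -> /eqP; rewrite eqn_leq ltnn.
pose u := sphere_proj w.
have uU' : u *m U'^T = 0 by rewrite -scalemxAl wU' scaler0.
have UU : col_mx u U' *m (col_mx u U')^T = 1%:M.
  rewrite tr_col_mx mul_col_row uU' UU' -[U' *m u^T]trmxK.
  rewrite trmx_mul trmxK uU' trmx0 [RHS](@scalar_mx_block _ 1 n 1).
  congr block_mx.
  by apply/matrixP => i j; rewrite !ord1 [LHS]sphere_proj_dotp// mxE.
have sUB : (col_mx u U' <= B)%MS.
  rewrite col_mx_sub -!eB; apply/andP; split.
    rewrite scalemx_sub// addmx_sub ?addsmxSl// eqmx_opp.
    by rewrite mulmx_sub// eU' addsmxSr.
  by rewrite eU' addsmxSr.
exists (col_mx u U'); split => //.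
apply/eqmxP; rewrite -(geq_leqif (mxrank_leqif_eq sUB)).
have /eqP -> := orthonormal_row_free UU.
exact: rank_leq_row.
Qed.

Lemma orthonormal_basis_ex n d (A : 'M[R]_d) : \rank A = n ->
  exists U : 'M[R]_(n, d), U *m U^T = 1%:M /\ (U :=: A)%MS.
Proof.
move=> <-; have [U [UU UA]] := gram_schmidt (row_base_free A).
by exists U; split => //; apply: eqmx_trans UA (eq_row_base A).
Qed.

Lemma onbP d (E : 'M[R]_d) : orthonormal_basis (onb E).
Proof.
have [U UE] := @orthonormal_basis_ex _ d E erefl.
by apply: (@xgetPex _ 0 [set U | orthonormal_basis U]); exists U.
Qed.

(** The first n rows of Q span the columns of G and the last k rows span their
    orthogonal complement. *)
Lemma orthogonal_triangulation n k (G : 'M[R]_(n + k, n)) : \rank G = n ->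
  exists (Q : 'M[R]_(n + k)) (L : 'M[R]_n),
    [/\ Q *m Q^T = 1%:M, L \in unitmx & Q *m G = col_mx L 0].
Proof.
move=> rG.
have [|W1 [WW1 W1G]] := @gram_schmidt _ _ G^T.
  by rewrite /row_free mxrank_tr rG.
have [|W2 [WW2 W2G]] := @orthonormal_basis_ex k _ (kermx G).
  by rewrite mxrank_ker rG addKn.
have W2G0 : W2 *m G = 0 by apply/sub_kermxP; rewrite W2G.
have W21 : W2 *m W1^T = 0.
  have /submxP[X ->] : (W1 <= G^T)%MS by rewrite W1G.
  by rewrite trmx_mul trmxK mulmxA W2G0 mul0mx.
have QQ : col_mx W1 W2 *m (col_mx W1 W2)^T = 1%:M.
  rewrite tr_col_mx mul_col_row WW1 WW2 W21 -[W1 *m _]trmxK.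
  by rewrite trmx_mul trmxK W21 trmx0 [RHS]scalar_mx_block.
exists (col_mx W1 W2), (W1 *m G); split => //; last by rewrite mul_col_mx W2G0.
have QG : col_mx W1 W2 *m G = col_mx (W1 *m G) 0 by rewrite mul_col_mx W2G0.
have uQ : row_full (col_mx W1 W2).
  by rewrite row_full_unit; case/mulmx1_unit: QQ.
rewrite -row_free_unit /row_free; apply/eqP.
rewrite -[RHS]rG -(eqmxMfull G uQ) QG.
by rewrite rank_col_mx0.
Qed.

End orthonormal_bases.

Section sphere_projection.
Local Open Scope ereal_scope.
Context {R : realType}.
Local Notation mu := (@rowvec_lebesgue R _).

Lemma sphere_proj_ball n (x : 'rV[R]_n) : euclidean_ball (sphere_proj x).
Proof.
rewrite /euclidean_ball/=; have [->|x0] := eqVneq x 0%R.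
  by rewrite /sphere_proj scaler0 /dotp mul0mx mxE.
by rewrite sphere_proj_dotp.
Qed.

Lemma lsubmx_ball m n (x : 'rV[R]_(m + n)) :
  euclidean_ball x -> euclidean_ball (lsubmx x).
Proof.
rewrite /euclidean_ball/= -{1 2}[x]hsubmxK dotp_row_mx; apply: le_trans.
by rewrite lerDl dotp_ge0.
Qed.

Lemma orthogonal_dotp n (Q : 'M[R]_n) (x : 'rV[R]_n) : Q *m Q^T = 1%:M ->
  dotp (x *m Q) (x *m Q) = dotp x x.
Proof. by move=> QQ; rewrite /dotp trmx_mul mulmxA -(mulmxA x) QQ mulmx1. Qed.

Lemma sphere_proj_orthogonal n (Q : 'M[R]_n) (x : 'rV[R]_n) : Q *m Q^T = 1%:M ->
  sphere_proj (x *m Q) = sphere_proj x *m Q.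
Proof. by move=> QQ; rewrite /sphere_proj orthogonal_dotp// scalemxAl. Qed.

Lemma mulmx_triangulation n k (G : 'M[R]_(n + k, n)) (Q : 'M[R]_(n + k))
    (L : 'M[R]_n) (z : 'rV[R]_(n + k)) :
  Q *m G = col_mx L 0%R -> z *m Q *m G = lsubmx z *m L.
Proof.
by move=> QG; rewrite -mulmxA QG -{1}[z]hsubmxK mul_row_col mulmx0 addr0.
Qed.

Lemma affine_ball_image n k (G : 'M[R]_(n + k, n)) (Q : 'M[R]_(n + k))
    (L : 'M[R]_n) (c : 'rV[R]_n) :
  Q *m Q^T = 1%:M -> Q *m G = col_mx L 0%R ->
  [set (c + y *m G)%R | y in euclidean_ball] =
  [set (c + w *m L)%R | w in euclidean_ball].
Proof.
move=> QQ QG; have QTQ : Q^T *m Q = 1%:M by apply: mulmx1C.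
apply/seteqP; split => _ [y yB <-].
  exists (lsubmx (y *m Q^T)).
    apply: lsubmx_ball; move: yB; rewrite /euclidean_ball/= orthogonal_dotp//.
    by rewrite trmxK.
  by rewrite -(mulmx_triangulation _ QG) -(mulmxA y) QTQ mulmx1.
exists (row_mx y 0 *m Q); last by rewrite (mulmx_triangulation _ QG) row_mxKl.
move: yB; rewrite /euclidean_ball/= orthogonal_dotp// dotp_row_mx.
by rewrite [X in (_ + X)%R]/dotp mul0mx mxE addr0.
Qed.

(** The rotation Q reduces the statement to the projection to the first
    coordinates, followed by the affine bijection of matrix L.  Applying
    Archimedes' theorem to U pulled back by that bijection and to the whole ball
    eliminates the constant. *)
Theorem sphere_proj_uniform n (G : 'M[R]_(n.+1 + 2, n.+1)) (c : 'rV[R]_n.+1)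
    (U : set 'rV[R]_n.+1) :
  \rank G = n.+1 -> measurable U ->
  let T := [set (c + y *m G)%R | y in euclidean_ball] in
  U `<=` T ->
  mu [set y | euclidean_ball y /\ U (c + sphere_proj y *m G)%R] * mu T =
  mu (@euclidean_ball R (n.+1 + 2)) * mu U.
Proof.
move=> rG mU T UT.
have [Q [L [QQ uL QG]]] := orthogonal_triangulation rG.
have TE : T = [set (c + w *m L)%R | w in euclidean_ball].
  exact: affine_ball_image QQ QG.
have zQG (z : 'rV[R]_(n.+1 + 2)) : z *m Q *m G = lsubmx z *m L.
  exact: mulmx_triangulation.
pose V := [set w : 'rV[R]_n.+1 | U (c + w *m L)%R].
have mV : measurable V.
  suff mf : measurable_fun setT (fun w : 'rV[R]_n.+1 => c + w *m L)%R.
    exact: (measurable_preimageT mf mU).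
  apply: (@measurable_rowvecD _ _ _ _ (cst c)) => //; exact: measurable_mulmxr.
have VB : V `<=` euclidean_ball.
  move=> w /UT; rewrite TE => -[x xB] /addrI /(congr1 (mulmx ^~ (invmx L))).
  by rewrite !mulmxK// => <-.
have [K KE] := archimedes (R := R) n.
have -> : mu (@euclidean_ball R (n.+1 + 2)) = K * mu (@euclidean_ball R n.+1).
  rewrite -KE//; last exact: measurable_euclidean_ball.
  congr (rowvec_lebesgue _ _); apply/seteqP; split => x; last by case.
  by move=> xB; split => //; apply: lsubmx_ball; exact: sphere_proj_ball.
pose S := [set y | euclidean_ball y /\ U (c + sphere_proj y *m G)%R].
have mS : measurable S.
  apply: measurableI; first exact: measurable_euclidean_ball.
  suff mf : measurable_fun setT
      (fun y : 'rV[R]_(n.+1 + 2) => c + sphere_proj y *m G)%R.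
    exact: (measurable_preimageT mf mU).
  apply: (@measurable_rowvecD _ _ _ _ (cst c)) => //.
  exact: (measurableT_comp (measurable_mulmxr G) (@measurable_sphere_proj R _)).
rewrite -[X in mu X * _]/S -(rowvec_lebesgue_orthogonal QQ mS).
have -> : [set y | S (y *m Q)] =
    [set x | euclidean_ball x /\ V (lsubmx (sphere_proj x))].
  apply/seteqP; split => z; rewrite /S /V /= sphere_proj_orthogonal// zQG;
  by rewrite /euclidean_ball/= orthogonal_dotp.
rewrite KE// -muleA -[RHS]muleA; congr (_ * _).
by rewrite TE muleC rowvec_lebesgue_affine_ball.
Qed.

End sphere_projection.

(** * Topology of Euclidean space *)

Section continuity.
Context {R : realType}.

Lemma continuous_finite_sum (T : topologicalType) (V : normedModType R) I (s : seq I)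
    (f : I -> T -> V) :
  (forall i, continuous (f i)) -> continuous (fun x => \sum_(i <- s) f i x).
Proof.
move=> cf; elim: s => [|i s IH] x.
  by under eq_fun do rewrite big_nil; exact: cvg_cst.
under eq_fun do rewrite big_cons.
by apply: cvgD; [exact: cf|exact: IH].
Qed.

Lemma continuous_mulmxr m n (M : 'M[R]_(m, n)) :
  continuous (fun u : 'rV[R]_m => u *m M).
Proof.
under eq_fun do rewrite mulmx_sum_row.
apply: continuous_finite_sum => i u.
by apply: (cvgZr_tmp (F := nbhs u)); exact: coord_continuous.
Qed.

Lemma continuous_dotp n : continuous (fun u : 'rV[R]_n => dotp u u).
Proof.
under eq_fun do rewrite dotpE.
apply: continuous_finite_sum => i u.
have ci := @coord_continuous R 1 n ord0 i u.
exact: (cvgM ci ci).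
Qed.

Lemma open_mulmxr m n (M : 'M[R]_(m, n)) (U : set 'rV[R]_n) : open U ->
  open [set u : 'rV[R]_m | U (u *m M)].
Proof. by apply: open_comp => u _; exact: continuous_mulmxr. Qed.

Lemma open_unit_ball_affine n (c : 'rV[R]_n) (M : 'M[R]_n) :
  open [set z : 'rV[R]_n | dotp ((z - c) *m M) ((z - c) *m M) < 1].
Proof.
have cz : continuous (fun z : 'rV[R]_n => (z - c) *m M).
  under eq_fun do rewrite mulmxBl.
  move=> z; have cm := @continuous_mulmxr n n M z.
  exact: (cvgB cm (cvg_cst _)).
apply: (@open_comp _ _ (fun z : 'rV[R]_n => dotp ((z - c) *m M) ((z - c) *m M))
  [set t | t < 1]); last exact: open_lt.
move=> z _; apply: (@continuous_comp _ _ _ (fun z : 'rV[R]_n => (z - c) *m M)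
  (fun u : 'rV[R]_n => dotp u u)); first exact: cz.
exact: continuous_dotp.
Qed.

(** A condition that holds near the endpoint of a radius of an ellipsoid already
    holds at some point further inside. *)
Lemma radial_approximation n (c v : 'rV[R]_n) (P : set 'rV[R]_n) :
  (\forall z \near (c + v), P z) ->
  exists t : R, [/\ 0 <= t, t < 1 & P (c + t *: v)].
Proof.
move=> nP.
have ct : {for 1, continuous (fun t : R => c + t *: v)}.
  apply: cvgD; first exact: cvg_cst.
  by apply: cvgZr_tmp; exact: cvg_id.
have : \forall t \near (1 : R), P (c + t *: v).
  by apply: ct; rewrite scale1r.
move=> /nbhs_ballP[e /= e0 eP].
exists (1 - Num.min (e / 2) 1); split.
- by rewrite subr_ge0 ge_min lexx orbT.
- by rewrite ltrBlDr ltrDl lt_min ltr01 divr_gt0.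
- apply: eP; rewrite -ball_normE /= opprB addrC subrK.
  rewrite ger0_norm ?le_min ?ler01 ?divr_ge0 ?ltW//.
  by rewrite gt_min ltr_pdivrMr// ltr_pMr// ltr1n.
Qed.

End continuity.

Section subspaces.
Context {R : realType} {d : nat}.
Implicit Types (E H : 'M[R]_d).

Lemma dotp_self_mx0 (x : 'rV[R]_d) : x *m x^T = 0 -> x = 0.
Proof. by move=> xx; apply/eqP; rewrite -dotp_eq0 /dotp xx mxE. Qed.

Lemma orthocompl_cap E : (E :&: orthocompl E)%MS = 0.
Proof.
apply/eqP; rewrite -submx0; apply/rV_subP => x; rewrite sub_capmx => /andP[].
move=> /submxP[D xD] /sub_kermxP xE; apply/eqP/eqP.
rewrite submx0; apply/eqP/dotp_self_mx0.
by rewrite {2}xD trmx_mul mulmxA xE mul0mx.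
Qed.

Lemma rank_orthocompl E : \rank (orthocompl E) = (d - \rank E)%N.
Proof. by rewrite mxrank_ker mxrank_tr. Qed.

Lemma orthocomplK H : (orthocompl (orthocompl H) :=: H)%MS.
Proof.
apply/eqmx_sym/eqmxP; rewrite -(geq_leqif (mxrank_leqif_eq _)).
  by rewrite !rank_orthocompl subKn// rank_leq_row.
apply/sub_kermxP; apply: trmx_inj.
by rewrite trmx_mul trmxK trmx0; apply/sub_kermxP.
Qed.

(** The matrix U^T U, where U is an orthonormal basis of E, is the orthogonal
    projection to E. *)
Lemma sub_onb_tr E (x : 'rV[R]_d) : (x - x *m (onb E)^T *m onb E <= orthocompl E)%MS.
Proof.
have [UU UE] := onbP E.
apply/sub_kermxP.
have /submxP[X EX] : (E <= onb E)%MS by rewrite UE.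
have -> : E^T = (onb E)^T *m X^T by rewrite -trmx_mul -EX.
rewrite mulmxA mulmxBl -(mulmxA _ (onb E)) UU mulmx1.
by rewrite subrr mul0mx.
Qed.

Lemma orthprojE E (x : 'rV[R]_d) : orthproj E x = x *m (onb E)^T *m onb E.
Proof.
have [UU UE] := onbP E.
have xE : (x *m (onb E)^T *m onb E <= E)%MS by rewrite -UE submxMl.
rewrite /orthproj -{1}[x](subrK (x *m (onb E)^T *m onb E)) mulmxDl.
rewrite (proj_mx_0 (orthocompl_cap E) (sub_onb_tr E x)) add0r.
by rewrite (proj_mx_id (orthocompl_cap E)).
Qed.

Lemma coords_orthproj E (K : set 'rV[R]_d) :
  coords E (orthproj E @` K) = [set x *m (onb E)^T | x in K].
Proof.
have [UU UE] := onbP E.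
apply/seteqP; split => u /=.
  move=> [x Kx]; rewrite orthprojE => xu; exists x => //.
  have := congr1 (mulmx ^~ (onb E)^T) xu.
  by rewrite -!mulmxA UU !mulmx1.
by move=> [x Kx <-]; exists x => //; rewrite orthprojE.
Qed.

Lemma relative_interior_sub E (B : set 'rV[R]_d) : relative_interior E B `<=` B.
Proof. by move=> x [Ex [U [oU Ux UB]]]; apply: UB. Qed.

Lemma open_coords_relative_interior E (B : set 'rV[R]_d) :
  open (coords E (relative_interior E B)).
Proof.
have [UU UE] := onbP E.
rewrite openE => u [_ [U [oU Uu UB]]].
have oV := open_mulmxr (M := onb E) oU.
apply: (@filterS _ _ _ [set v | U (v *m onb E)]); last exact: open_nbhs_nbhs.
move=> v /= Uv; split; first by rewrite /subspace_set/= -UE submxMl.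
by exists U.
Qed.

End subspaces.

(** * Cylinders in an ellipsoid *)

Section ellipsoids.
Local Open Scope ereal_scope.
Context {R : realType}.
Local Notation mu := (@rowvec_lebesgue R _).

Lemma measurable_affine_ball n (c : 'rV[R]_n) (L : 'M[R]_n) : L \in unitmx ->
  measurable [set (c + y *m L)%R | y in euclidean_ball].
Proof.
move=> uL; have mf : measurable_fun setT (fun x : 'rV[R]_n => (x - c) *m invmx L)%R.
  apply: (measurableT_comp (measurable_mulmxr (invmx L))).
  by apply: (@measurable_rowvecD _ _ _ _ id (cst _)).
rewrite (_ : [set _ | _ in _] = (fun x => (x - c) *m invmx L)%R @^-1` euclidean_ball).
  exact: (measurable_preimageT mf (@measurable_euclidean_ball R n)).
apply/seteqP; split => [_ [y yB <-]|x /= xB].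
  by rewrite /= addrC addKr mulmxK.
by exists ((x - c) *m invmx L)%R => //; rewrite mulmxKV// addrC subrK.
Qed.

(** The product of this volume with that of the preimage of the ball is the square
    of the volume of the ball, which is finite and nonzero; so are both
    factors. *)
Lemma rowvec_lebesgue_affine_ball_gt0 n (c : 'rV[R]_n) (L : 'M[R]_n) :
  L \in unitmx ->
  0 < mu [set (c + y *m L)%R | y in euclidean_ball] < +oo.
Proof.
move=> uL; set T := [set _ | _ in _].
have mU : measurable [set x : 'rV[R]_n | euclidean_ball (x - c)%R].
  suff mf : measurable_fun setT (fun x : 'rV[R]_n => x - c)%R.
    exact: (measurable_preimageT mf (@measurable_euclidean_ball R n)).
  by apply: (@measurable_rowvecD _ _ _ _ id (cst _)).
have := rowvec_lebesgue_affine_ball c uL mU.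
rewrite [mu [set x | euclidean_ball (x - c)%R]]rowvec_lebesgueD; last first.
  exact: measurable_euclidean_ball.
have /andP[b0 boo] := @rowvec_lebesgue_ball R n.
set b := mu euclidean_ball; set x := (X in _ * X = _).
have x0 : 0 <= x by exact: measure_ge0.
have T0 : 0 <= mu T by exact: measure_ge0.
have bb : 0 < b * b < +oo.
  by rewrite mule_gt0//= lte_mul_pinfty// ?ltW// ge0_fin_numE// ltW.
move=> Tx; move: bb; rewrite -Tx => /andP[Tx0 Txoo].
have x_gt0 : 0 < x.
  by rewrite lt0e x0 andbT; apply/negP => /eqP xE; move: Tx0; rewrite xE mule0 ltxx.
apply/andP; split.
  by rewrite lt0e T0 andbT; apply/negP => /eqP xE; move: Tx0; rewrite xE mul0e ltxx.
rewrite ltNge leye_eq; apply/negP => /eqP TE; move: Txoo.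
by rewrite TE gt0_mulye// ltxx.
Qed.

(** The dimension of the target is related to that of the source by an equation,
    since it will be the rank of a matrix; T is the shadow of an ellipsoid in
    coordinates of a subspace. *)
Theorem shadow_uniform d m (G : 'M[R]_(d, m)) (c : 'rV[R]_m)
    (U : set 'rV[R]_m) : (0 < m)%N -> d = (m + 2)%N -> \rank G = m ->
  let T := [set (c + y *m G)%R | y in euclidean_ball] in
  measurable U -> U `<=` T ->
  [/\ measurable T, 0 < mu T < +oo &
   mu [set y | euclidean_ball y /\ U (c + sphere_proj y *m G)%R] * mu T =
   mu (@euclidean_ball R d) * mu U].
Proof.
case: m => // n in G c U * => _ dE; subst d => rG T mU UT.
have [L uL TE] : exists2 L : 'M[R]_n.+1, L \in unitmx &
    T = [set (c + w *m L)%R | w in euclidean_ball].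
  have [Q [L [QQ uL QG]]] := orthogonal_triangulation rG.
  by exists L => //; exact: affine_ball_image QQ QG.
split; [|by rewrite TE; exact: rowvec_lebesgue_affine_ball_gt0|].
  by rewrite TE; exact: measurable_affine_ball.
exact: sphere_proj_uniform.
Qed.

End ellipsoids.

Lemma mule_cross (R : realType) (s t b a : \bar R) :
  (0 < t < +oo)%E -> (0 < b < +oo)%E -> (s * t = b * a)%E -> (a / t = s / b)%E.
Proof.
case: t => [t||]; rewrite ?ltxx ?andbF// lte_fin => /andP[t0 _].
case: b => [b||]; rewrite ?ltxx ?andbF// lte_fin => /andP[b0 _] stba.
have aE : a = (b^-1%:E * (s * t%:E))%E.
  by rewrite stba muleA -EFinM mulVf ?gt_eqF// mul1e.
rewrite !inver !gt_eqF// aE -!muleA -EFinM divff ?gt_eqF// mule1.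
exact: muleC.
Qed.

Section cylinders_in_ellipsoid.
Local Open Scope ereal_scope.
Context {R : realType} (d : nat).
Local Notation mu := (@rowvec_lebesgue R _).
Variables (c : 'rV[R]_d) (A : 'M[R]_d) (uA : A \in unitmx).
Let K : set 'rV[R]_d := [set (c + y *m A)%R | y in euclidean_ball].

(** The cylinder over the relative interior of the base, expressed in the
    coordinates in which volumes are measured. *)
Definition open_cyl (C : cylinder R d 2) : set 'rV[R]_d :=
  [set x | coords (cyl_space C) (relative_interior (cyl_space C) (cyl_base C))
             (x *m (onb (cyl_space C))^T)].

(** The volume of this part of the unit ball represents the measure of the part of
    the boundary of K that lies in the open cylinder. *)
Definition ball_cone (C : cylinder R d 2) : set 'rV[R]_d :=
  [set y | euclidean_ball y /\ open_cyl C (c + sphere_proj y *m A)%R].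

Lemma lebesgue_outer_ge0 n (B : set 'rV[R]_n) : 0 <= lebesgue_outer B.
Proof.
apply: le_ereal_inf_tmp => _ [D [a [b [ab _ ->]]]].
by apply: esum_ge0 => k _; rewrite lee_fin box_vol_ge0.
Qed.

Lemma open_open_cyl C : open (open_cyl C).
Proof. exact/(open_mulmxr (M := (onb _)^T))/open_coords_relative_interior. Qed.

Lemma measurable_ball_cone C : measurable (ball_cone C).
Proof.
apply: measurableI; first exact: measurable_euclidean_ball.
suff mf : measurable_fun setT (fun y : 'rV[R]_d => c + sphere_proj y *m A)%R.
  exact: (measurable_preimageT mf (open_measurable_rowvec (@open_open_cyl C))).
apply: (@measurable_rowvecD _ _ _ _ (cst c)) => //.
exact: (measurableT_comp (measurable_mulmxr A) (@measurable_sphere_proj R _)).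
Qed.

Lemma open_cyl_sub C : open_cyl C `<=` cyl_set C.
Proof.
move=> x /relative_interior_sub Bx.
exists (x *m (onb (cyl_space C))^T *m onb (cyl_space C)) => //.
exists (x - x *m (onb (cyl_space C))^T *m onb (cyl_space C))%R.
  by rewrite /subspace_set/= -(orthocomplK (cyl_dir C)) sub_onb_tr.
by rewrite addrC subrK.
Qed.

(** In fact equality holds; the upper bound only uses the inequalities between
    Lebesgue measure and the outer measure that are valid for open sets in the
    numerator and for measurable sets in the denominator. *)
Lemma crv_le_ball_cone C : (3 <= d)%N -> interior_full C ->
  cyl_base C `<=` orthproj (cyl_space C) @` K ->
  crv K C <= mu (ball_cone C) / mu (@euclidean_ball R d).
Proof.
move=> d3 fC BK.
set E := cyl_space C; set P := onb E.
have [UU UE] := onbP E.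
have rE : d = (\rank E + 2)%N.
  by rewrite rank_orthocompl (cyl_dir_dim C) subnK// (leq_trans _ d3).
have rE0 : (0 < \rank E)%N by rewrite -(ltn_add2r 2) -rE.
have rP : \rank (A *m P^T) = \rank E.
  rewrite eqmxMfull ?row_full_unit// mxrank_tr.
  exact/eqP/orthonormal_row_free.
pose V := coords E (relative_interior E (cyl_base C)).
have oV : open V := @open_coords_relative_interior R d E (cyl_base C).
have KT : coords E (orthproj E @` K) =
    [set (c *m P^T + y *m (A *m P^T))%R | y in euclidean_ball].
  rewrite coords_orthproj; apply/seteqP; split => [_ [_ [y yB <-] <-]|_ [y yB <-]].
    by exists y => //; rewrite mulmxDl mulmxA.
  by exists (c + y *m A)%R; [exists y|rewrite mulmxDl mulmxA].
have VT : V `<=` coords E (orthproj E @` K).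
  by move=> u /relative_interior_sub; exact: BK.
rewrite KT in VT.
have [mT /andP[T0 Too] ST] := shadow_uniform rE0 rE rP
  (open_measurable_rowvec oV) VT.
set T := [set _ | _ in _] in mT T0 Too ST.
have SE : [set y | euclidean_ball y /\ V (c *m P^T + sphere_proj y *m (A *m P^T))%R]
    = ball_cone C.
  by apply/seteqP; split => y /=; rewrite /ball_cone/open_cyl/= mulmxDl mulmxA.
rewrite SE in ST.
have num : subspace_vol E (cyl_base C) <= mu V.
  apply: le_trans (outer_le_rowvec_lebesgue oV).
  apply: le_trans (lebesgue_outerU_null V fC).
  apply: le_lebesgue_outer => u Bu.
  by have [Vu|Vu] := pselect (V u); [left|right].
have den : mu T <= subspace_vol E (orthproj E @` K).
  by rewrite /subspace_vol KT; exact: rowvec_lebesgue_le_outer.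
apply: (@le_trans _ _ (mu V / mu T)).
  apply: lee_pmul => //; first exact: lebesgue_outer_ge0.
    by rewrite inve_ge0 (le_trans _ den)// ltW.
  by rewrite lee_pV2// inE ?(le_trans _ den)// ltW.
by rewrite (mule_cross _ _ ST) ?T0//; exact: rowvec_lebesgue_ball.
Qed.

(** A boundary point of K is never interior to a truncated cylinder, so the
    packing condition is applied at a nearby point x of the open ellipsoid O,
    chosen in all the relevant open cylinders simultaneously. *)
Lemma ball_cone_multiplicity N r (C : 'I_N -> cylinder R d 2) (y : 'rV[R]_d) :
  packing_in r K C -> euclidean_ball y ->
  (#|[pred i | `[< ball_cone (C i) y >]]| <= r)%N.
Proof.
move=> [_ pK] yB.
set v := (sphere_proj y *m A)%R.
have : \forall z \near (c + v)%R,
    forall i, ball_cone (C i) y -> open_cyl (C i) z.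
  apply: (@filter_forall _ _
    (fun i => [set z | ball_cone (C i) y -> open_cyl (C i) z])
    (nbhs (c + v)%R)) => i.
  have [Ci|nCi] := pselect (ball_cone (C i) y); last first.
    by apply: (@filterE _ (nbhs (c + v)%R)) => z /nCi.
  apply: (@filterS _ (nbhs (c + v)%R) _ (open_cyl (C i))); first by move=> z zC _.
  by apply: open_nbhs_nbhs; split; [exact: open_open_cyl|exact: Ci.2].
move=> /radial_approximation[t [t0 t1 tC]].
set x := (c + t *: v)%R in tC.
pose O := [set z : 'rV[R]_d |
  (dotp ((z - c) *m invmx A) ((z - c) *m invmx A) < 1)%R].
have Ox : O x.
  rewrite /O /x /= addrC addKr -scalemxAl mulmxK// dotpZ.
  rewrite (le_lt_trans (_ : _ <= t ^+ 2)%R) ?expr_lt1//.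
  by rewrite ler_piMr ?sqr_ge0//; exact: sphere_proj_ball.
have OK : O `<=` K.
  move=> z /ltW zO; exists ((z - c) *m invmx A)%R => //.
  by rewrite mulmxKV// addrC subrK.
apply: leq_trans (pK x (OK _ Ox)); apply: subset_leq_card.
apply/fintype.subsetP => i; rewrite !inE => iC.
have oO : open O by exact: open_unit_ball_affine.
suff : nbhs x (cyl_set (C i) `&` K) by [].
apply: (@filterS _ (nbhs x) _ (open_cyl (C i) `&` O)).
  by move=> z [zC zO]; split; [exact: open_cyl_sub|exact: OK].
apply: (@filterI _ (nbhs x)).
  by apply: open_nbhs_nbhs; split; [exact: open_open_cyl|exact: (tC i iC)].
by apply: open_nbhs_nbhs; split.
Qed.

Lemma sum_ball_cone N r (C : 'I_N -> cylinder R d 2) : packing_in r K C ->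
  \sum_(i < N) mu (ball_cone (C i)) <= r%:R%:E * mu (@euclidean_ball R d).
Proof.
move=> pC; have mB := @measurable_euclidean_ball R d.
have -> : \sum_(i < N) mu (ball_cone (C i)) =
    \int[mu]_(y in euclidean_ball) (\sum_(i < N) (\1_(ball_cone (C i)) y)%:E).
  rewrite ge0_integral_sum//.
    apply: eq_bigr => i _; rewrite integral_indic//; last exact: measurable_ball_cone.
    congr (rowvec_lebesgue _ _); apply/seteqP; split => y; last by case.
    by move=> [yB yC]; split.
  move=> i; apply/measurable_EFinP; apply: measurable_indic.
  exact: measurable_ball_cone.
rewrite -[mu euclidean_ball]mul1e -(integral_cst mu mB).
rewrite -ge0_integralZl//.
apply: ge0_le_integral => //.
- by move=> y _; apply: sume_ge0 => i _; rewrite lee_fin.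
- apply: emeasurable_sum => i; apply/measurable_EFinP; apply: measurable_indic.
  exact: measurable_ball_cone.
move=> y yB; rewrite mule1 sumEFin lee_fin.
rewrite (eq_bigr (fun i => (`[< ball_cone (C i) y >])%:R)); last first.
  by move=> i _; rewrite indicE; congr (_%:R); apply/idP/asboolP => /set_mem.
rewrite -natr_sum ler_nat.
apply: leq_trans (ball_cone_multiplicity pC yB).
rewrite -sum1_card [leqRHS]big_mkcond; apply: leq_sum => i _.
by rewrite inE; case: asboolP.
Qed.

End cylinders_in_ellipsoid.

Theorem theorem4p4 (R : realType) (d : nat) (hd : (3 <= d)%N)
  (K : set 'rV[R]_d) (hK : ellipsoid K) (r : nat) (hr : (1 <= r)%N)
  (N : nat) (C : 'I_N -> cylinder R d 2)
  (hC : forall i, interior_full (C i))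
  (hpack : packing_in r K C) :
  (\sum_(i < N) crv K (C i) <= r%:R%:E)%E.
Proof.
have [c [A [uA KE]]] := hK; rewrite KE in hpack *.
set b := rowvec_lebesgue d (@euclidean_ball R d).
have /andP[b0 boo] : (0 < b < +oo)%E := rowvec_lebesgue_ball d.
apply: (@le_trans _ _ (\sum_(i < N) rowvec_lebesgue d (ball_cone c A (C i)) / b)%E).
  by apply: lee_sum => i _; apply: crv_le_ball_cone => //; exact: hpack.1.
rewrite -ge0_sume_distrl; last by move=> i _; exact: measure_ge0.
have bE : b = (fine b)%:E by rewrite fineK// ge0_fin_numE// ltW.
have fb0 : 0 < fine b by rewrite fine_gt0// b0 boo.
rewrite bE inver gt_eqF// lee_pdivrMr// -bE.
exact: sum_ball_cone.
Qed.
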